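(* Let $q\ge1$, $n_1\ge n_2\ge\cdots\ge n_d\ge 1$ be integers, $n=\prod_{j=1}^d n_j$, and suppose the noise variables $\varepsilon_i$ are i.i.d. $N(0,\sigma^2)$ in the lattice design. Let $\Delta(\mathbf f_n/\sigma)=\{f(\mathbf n)-f(\mathbf 1)\}/\sigma$, $\Delta_n^*\ge0$, $n_{d+1}=1$, $n_s^*=\prod_{j=1}^s n_j$, $t_s=n_s^*/n_s^s$ for $1\le s\le d+1$ (so $t_1=1$, $t_{d+1}=n$), $t_{d+2}=\infty$, and $s_q=\lceil 2/(q-1)\rceil\wedge(d+1)$ (with $s_1=d+1$). Let $h_0(t)=\Delta_n^*\sqrt t$ and define $H$ piecewise by $$H(t)=\min\big\{1,\ h_0(t)/(n_s^*/t)^{1/(s\wedge d)}\big\},\quad t\in[t_s,t_{s+1}],\ s=1,\ldots,d+1.$$ Then $$\inf_{\widehat{\mathbf f}}\ \sup\Big\{R_q(\widehat{\mathbf f},\mathbf f_n):\ \mathbf f_n\in\mathscr F_n,\ \Delta(\mathbf f_n/\sigma)\le\Delta_n^*\Big\}\ \gtrsim_{q,d}\ \sigma^q\max\Big\{(t\wedge n)^{-q/2}H(t):\ t\wedge h_0(t)\ge1\Big\},$$ and the right-hand side equals $\sigma^q$ times $$\begin{cases}1,& n_1\le\Delta_n^*,\\ \big(\Delta_n^*/(n_s^* )^{1/s}\big)^{qs/(2+s)},& n_{s+1}/t_{s+1}^{1/2}\le\Delta_n^*\le n_s/t_s^{1/2},\ 1\le s<s_q,\\ \Delta_n^*/\big(n_st_s^{(q-1)/2}\big),&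 t_s^{-1/2}\le\Delta_n^*\le n_s/t_s^{1/2},\ s=s_q\le d,\\ (\Delta_n^* )^{q-2/s}/(n_s^* )^{1/s},& t_{s+1}^{-1/2}\le\Delta_n^*\le t_s^{-1/2},\ s_q\le s\le d,\\ n^{-q/2},&0\le\Delta_n^*\le n^{-1/2}.\end{cases}$$ In particular, when $n_1=\cdots=n_d=n^{1/d}$ and $\Delta_n^*\ge n^{-1/2}$, the right-hand side is $$\sigma^q\times\begin{cases}\min\big\{1,(\Delta_n^*/n^{1/d})^{qd/(d+2)}\big\},& q\le1+2/d,\\ \min\big\{1,\ \Delta_n^*/n^{1/d},\ (\Delta_n^* )^{q-2/d}/n^{1/d}\big\},& q\ge1+2/d.\end{cases}$$
   Context: Lattice design: $V=[\mathbf 1,\mathbf n]=\prod_{j=1}^d\{1,\ldots,n_j\}$, $\mathbf n=(n_1,\ldots,n_d)^T$, $\mathbf 1=(1,\ldots,1)^T$, and the design points $x_1,\ldots,x_n$ enumerate $V$, each point once. We observe $y_i=f(x_i)+\varepsilon_i$, $i=1,\ldots,n$, with $\sigma>0$. $\mathscr F$ is the class of functions $f:V\to\mathbb R$ that are non-decreasing in each coordinate; $\mathbf f_n=(f(x_1),\ldots,f(x_n))^T$ and $\mathscr F_n=\{\mathbf f_n:f\in\mathscr F\}\subset\mathbb R^n$. $R_q(\widehat{\mathbf f},\mathbf f_n)=n^{-1}\sum_{i=1}^n\mathbb E|\widehat f(x_i)-f(x_i)|^q$. The infimum is over all estimators (functions of $y_1,\ldots,y_n$). $a\wedge b=\min(a,b)$.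 $A\gtrsim_{q,d}B$ means $A\ge c_{q,d}B$ with a constant $c_{q,d}>0$ depending only on $(q,d)$. When $\Delta_n^*=0$ the set $\{t:t\wedge h_0(t)\ge1\}$ is empty and the maximum is understood to be $n^{-q/2}$. *)

(* Defs.v *)
(* MathComp / MathComp-Analysis *)
From mathcomp Require Import all_boot all_order all_algebra.
From mathcomp Require Import all_classical all_reals all_analysis.
Set Implicit Arguments.
Unset Strict Implicit.
Unset Printing Implicit Defensive.
Import Order.TTheory GRing.Theory Num.Theory.
Local Open Scope classical_set_scope.
Local Open Scope ring_scope.

(* The side lengths (n_1, ..., n_d) are a tuple ns : d.-tuple nat.  The index
   j of [side] is 1-based; the default value of [nth] makes n_(d+1) = 1. *)
Definition side (d : nat) (ns : d.-tuple nat) (j : nat) : nat :=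
  nth 1%N ns j.-1.

Definition nstar (d : nat) (ns : d.-tuple nat) (s : nat) : nat :=
  (\prod_(1 <= j < s.+1) side ns j)%N.

(* The number n of design points. *)
Definition npts (d : nat) (ns : d.-tuple nat) : nat :=
  (\prod_(j < d) tnth ns j)%N.

Section Lattice.
Variables (R : realType) (d : nat) (ns : d.-tuple nat).

Definition lattice : set (d.-tuple nat) :=
  [set v | forall j, (1 <= tnth v j <= tnth ns j)%N].

(* A function on the lattice is represented by a function on all of nat^d, of
   which only the restriction to the lattice is ever used. *)
Definition coord_nondecreasing (f : d.-tuple nat -> R) : Prop :=
  forall (u v : d.-tuple nat) (j : 'I_d), lattice u -> lattice v ->
    (forall k, k != j -> tnth u k = tnth v k) ->
    (tnth u j <= tnth v j)%N -> f u <= f v.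

Definition value_vector (x : 'I_(npts ns) -> d.-tuple nat)
    (f : d.-tuple nat -> R) : (npts ns).-tuple R :=
  [tuple f (x i) | i < npts ns].

(* Delta(f_n / sigma); the upper corner of the lattice is ns itself. *)
Definition total_range (sigma : R) (f : d.-tuple nat -> R) : R :=
  (f ns - f [tuple 1%N | _ < d]) / sigma.

Definition monotone_class (x : 'I_(npts ns) -> d.-tuple nat)
    (sigma Delta : R) : set ((npts ns).-tuple R) :=
  [set value_vector x f | f in
    [set f | coord_nondecreasing f /\ total_range sigma f <= Delta]].

End Lattice.

Section Model.
Variables (R : realType) (disp : measure_display) (T : measurableType disp).
Variables (P : probability T R) (n : nat) (eps : 'I_n -> {RV P >-> R}).

Definition mutually_independent : Prop :=
  forall (J : {set 'I_n}) (A : 'I_n -> set R),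
    (forall i, measurable (A i)) ->
    P (\bigcap_(i in [set i | i \in J]) (eps i @^-1` A i)) =
      (\prod_(i in J) P (eps i @^-1` A i))%E.

Definition iid_gaussian (sigma : R) : Prop :=
  mutually_independent /\
  forall i, distribution P (eps i) = normal_prob 0 sigma.

Definition observation (fn : n.-tuple R) (w : T) : n.-tuple R :=
  [tuple tnth fn i + eps i w | i < n].

Definition risk (q : R) (fhat : n.-tuple R -> n.-tuple R) (fn : n.-tuple R) :
    \bar R :=
  ((n%:R^-1)%:E *
   \sum_(i < n)
     'E_P[fun w => (`|tnth (fhat (observation fn w)) i - tnth fn i| `^ q)%R])%E.

Definition minimax_risk (q : R) (F : set (n.-tuple R)) : \bar R :=
  ereal_inf [set ereal_sup [set risk q fhat fn | fn in F] |
    fhat in [set fhat : n.-tuple R -> n.-tuple R | measurable_fun setT fhat]].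

End Model.

Section Rate.
Variables (R : realType) (q : R) (d : nat) (ns : d.-tuple nat) (Delta : R).

Definition knot (s : nat) : R := (nstar ns s)%:R / (side ns s)%:R ^+ s.

Definition s_q : nat :=
  if q == 1 then d.+1 else minn `|Num.ceil (2 / (q - 1))|%N d.+1.

Definition h0 (t : R) : R := Delta * Num.sqrt t.

Definition Hpiece (s : nat) (t : R) : R :=
  Num.min 1 (h0 t / ((nstar ns s)%:R / t) `^ (minn s d)%:R^-1).

(* For t >= 1, the last index s <= d + 1 with t_s <= t; see [H_pieceE] for the
   agreement of the pieces at the shared endpoints. *)
Definition piece (t : R) : nat := \max_(1 <= s < d.+2 | knot s <= t) s.

Definition H (t : R) : R := Hpiece (piece t) t.

Definition rate_values : set R :=
  [set (Num.min t (npts ns)%:R) `^ (- q / 2) * H t |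
    t in [set t | 1 <= Num.min t (h0 t)]].

(* M is the maximum of [rate_values], with its conventional value when
   Delta = 0 and that set is empty. *)
Definition is_rate_max (M : R) : Prop :=
  if Delta == 0 then M = (npts ns)%:R `^ (- q / 2)
  else rate_values M /\ ubound rate_values M.

(* The five-case formula, as a relation because the ranges of Delta share
   endpoints. *)
Inductive rate_case : R -> Prop :=
| RateOne :
    (side ns 1)%:R <= Delta ->
    rate_case 1
| RateBelow s :
    (1 <= s < s_q)%N ->
    (side ns s.+1)%:R / Num.sqrt (knot s.+1) <= Delta ->
    Delta <= (side ns s)%:R / Num.sqrt (knot s) ->
    rate_case
      ((Delta / (nstar ns s)%:R `^ s%:R^-1) `^ (q * s%:R / (2 + s%:R)))
| RateAt s :
    s = s_q -> (s <= d)%N ->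
    (Num.sqrt (knot s))^-1 <= Delta ->
    Delta <= (side ns s)%:R / Num.sqrt (knot s) ->
    rate_case (Delta / ((side ns s)%:R * knot s `^ ((q - 1) / 2)))
| RateAbove s :
    (s_q <= s <= d)%N ->
    (Num.sqrt (knot s.+1))^-1 <= Delta ->
    Delta <= (Num.sqrt (knot s))^-1 ->
    rate_case (Delta `^ (q - 2 / s%:R) / (nstar ns s)%:R `^ s%:R^-1)
| RateParametric :
    0 <= Delta ->
    Delta <= (Num.sqrt (npts ns)%:R)^-1 ->
    rate_case ((npts ns)%:R `^ (- q / 2)).

End Rate.

Section PieceAgreement.
Variables (R : realType) (d : nat) (ns : d.-tuple nat) (Delta : R).
Hypothesis ns_noninc :
  forall i j : 'I_d, (i <= j)%N -> (tnth ns j <= tnth ns i)%N.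
Hypothesis ns_ge1 : forall j, (1 <= tnth ns j)%N.

Local Notation knot := (knot R ns).

Lemma side_gt0 j : (0 < side ns j)%N.
Proof.
rewrite /side; have [jd|dj] := ltnP j.-1 d; last by rewrite nth_default ?size_tuple.
by have := ns_ge1 (Ordinal jd); rewrite (tnth_nth 1%N).
Qed.

Lemma side_noninc s : (1 <= s)%N -> (side ns s.+1 <= side ns s)%N.
Proof.
case: s => // s _; rewrite /side /=.
have [sd|ds] := ltnP s.+1 d.
  have := ns_noninc (i := Ordinal (ltnW sd)) (j := Ordinal sd) (leqnSn s).
  by rewrite !(tnth_nth 1%N).
by rewrite [leqLHS]nth_default ?size_tuple//; exact: (side_gt0 s.+1).
Qed.

Lemma nstarS s : nstar ns s.+1 = (nstar ns s * side ns s.+1)%N.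
Proof. by rewrite /nstar big_nat_recr. Qed.

Lemma nstar_gt0 s : (0 < nstar ns s)%N.
Proof. by rewrite /nstar prodn_gt0// => j; exact: side_gt0. Qed.

Lemma nstar_npts : nstar ns d = npts ns.
Proof.
rewrite /nstar /npts big_add1 /= big_mkord; apply: eq_bigr => i _.
by rewrite /side /= (tnth_nth 1%N).
Qed.

Lemma knotS s : knot s.+1 = (nstar ns s)%:R / (side ns s.+1)%:R ^+ s.
Proof.
have u : (side ns s.+1)%:R != 0 :> R by rewrite pnatr_eq0 -lt0n side_gt0.
by rewrite /Defs.knot nstarS natrM exprS invfM mulrA mulfK.
Qed.

Lemma knot_gt0 s : 0 < knot s.
Proof. by rewrite divr_gt0 ?exprn_gt0 ?ltr0n ?side_gt0 ?nstar_gt0. Qed.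

Lemma le_knotS s : (1 <= s)%N -> knot s <= knot s.+1.
Proof.
move=> s1; rewrite knotS ler_pM2l ?ltr0n ?nstar_gt0//.
rewrite lef_pV2 ?posrE ?exprn_gt0 ?ltr0n ?side_gt0//.
by rewrite lerXn2r ?nnegrE ?ler0n// ler_nat side_noninc.
Qed.

Lemma powR_root (a : R) s : (0 < s)%N -> 0 <= a -> (a ^+ s) `^ s%:R^-1 = a.
Proof.
move=> s0 a0; rewrite -powR_mulrn// -powRrM mulfV ?powRr1//.
by rewrite pnatr_eq0 -lt0n.
Qed.

Lemma Hpiece_knotS s : (1 <= s <= d)%N ->
  Hpiece ns Delta s (knot s.+1) = Hpiece ns Delta s.+1 (knot s.+1).
Proof.
move=> /andP[s1 sd]; rewrite /Hpiece; congr (Num.min 1 (_ / _)).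
have N0 m : (nstar ns m)%:R != 0 :> R by rewrite pnatr_eq0 -lt0n nstar_gt0.
have -> : (nstar ns s)%:R / knot s.+1 = (side ns s.+1)%:R ^+ s.
  by rewrite knotS invf_div mulrC divfK.
have -> : (nstar ns s.+1)%:R / knot s.+1 = (side ns s.+1)%:R ^+ s.+1.
  by rewrite /Defs.knot invf_div mulrC divfK.
rewrite (minn_idPl sd) powR_root//.
have [sd'|ds] := ltnP s d; first by rewrite (minn_idPl sd') powR_root.
have -> : side ns s.+1 = 1%N by rewrite /side nth_default ?size_tuple.
by rewrite !expr1n powR1.
Qed.

(* H is given by the s-th formula on the whole closed interval
   [t_s, t_(s+1)], with t_(d+2) = +oo. *)
Lemma H_pieceE s t : (1 <= s <= d.+1)%N ->
  knot s <= t -> ((s <= d)%N -> t <= knot s.+1) ->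
  H ns Delta t = Hpiece ns Delta s t.
Proof.
move=> /andP[s1 sd] st tS; rewrite /H.
have pd : (piece ns t <= d.+1)%N.
  rewrite /piece big_nat_cond; elim/big_ind: _ => // [a b|i].
    by rewrite geq_max => -> ->.
  by move=> /andP[/andP[_]].
have sp : (s <= piece ns t)%N.
  rewrite /piece; apply: (@leq_bigmax_seq _ _ (fun i => knot i <= t) id s) => //.
  by rewrite mem_index_iota s1 ltnS.
have kp : knot (piece ns t) <= t.
  have : piece ns t = 0%N \/ knot (piece ns t) <= t.
    rewrite /piece; elim/big_ind: _ => [|a b|i it]; [by left| |by right].
    by rewrite /maxn; case: ifP.
  by case=> // p0; move: sp; rewrite p0 leqNgt s1.
move: (piece ns t) pd sp kp => p pd sp kp.
rewrite -(subnKC sp) in pd kp *; move: (p - s)%N pd kp => k {p sp}.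
elim: k => [|k IH]; first by rewrite addn0.
rewrite addnS => pd kp.
have mono m : knot s.+1 <= knot (s.+1 + m).
  elim: m => [|m]; first by rewrite addn0.
  by move/le_trans; apply; rewrite addnS le_knotS.
have tE : t = knot (s + k).+1.
  apply/le_anti/andP; split=> //; apply: le_trans (tS _) _.
    by rewrite -ltnS (leq_trans _ pd)// ltnS leq_addr.
  by rewrite -addSn.
rewrite [in LHS]tE -Hpiece_knotS.
  rewrite -tE IH//; first exact: ltnW.
  apply: le_trans kp; apply: le_knotS; exact: leq_trans s1 (leq_addr _ _).
by rewrite (leq_trans s1) ?leq_addr//= -ltnS.
Qed.

End PieceAgreement.

(* Main.v *)
Require Import Defs.
From HB Require Import structures.
From mathcomp Require Import all_boot all_order all_algebra.
From mathcomp Require Import all_classical all_reals all_analysis.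
From mathcomp Require Import measurable_realfun ring lra.
Import Order.TTheory GRing.Theory Num.Theory.
Local Open Scope classical_set_scope.
Local Open Scope ring_scope.

Set Implicit Arguments.
Unset Strict Implicit.
Unset Printing Implicit Defensive.

(** Write N_s for the product n_1 ... n_s.

    Lower bound.  Fix a scale t between t_s and t_(s+1), with s <= d, and let
    l = (N_s / t)^(1/s); then n_(s+1) <= l <= n_s.  Cut the lattice into boxes
    of side floor(n_j / l) in the directions j <= s and of side 1 in the
    others.  A box contains at most t design points, and the sum of its box
    coordinates, called its level, takes at most 2 d l + 1 values.  Let delta
    be of the order of sigma / sqrt t.  A function that climbs by delta from
    each level to the next stays non-decreasing in each coordinate when any
    set of boxes is raised by a further delta.  If the climb is confined to a
    window of k = floor(h_0(t)) consecutive levels, its total range fits in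
    sigma Delta, and by pigeonhole some window contains a fraction of the
    design points which is at least of the order of
    min(1, h_0(t) / l) = H(t).  Raising a single box moves the vector of means
    by at most sigma / 2 in Euclidean norm, too little to be detected
    reliably, so that after averaging over all sets of raised boxes every
    design point of the window contributes at least of the order of delta^q
    to the risk ([assouad]).  This gives sigma^q t^(-q/2) H(t)
    ([rate_lower_bound]).  Scales t >= n contribute at most n^(-q/2), for
    which two constant functions suffice ([parametric_lower_bound]).

    Gaussian shifts.  If eps has i.i.d. N(0, sigma^2) coordinates and L is the
    likelihood ratio of theta + eps with respect to eps, the pointwise
    inequality L <= 1 + L^2 / 4 and E L^2 = exp(|theta|^2 / sigma^2) give
    P(theta + eps in B) <= P(eps in B) + exp(|theta|^2 / sigma^2) / 4
    ([gauss_shift_bound]).  That L is the likelihood ratio is checked on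
    rectangles, where independence turns the expectation into a product of
    one-dimensional Gaussian integrals, and extends to all measurable sets
    because rectangles form a generating pi-system ([gauss_shift_law]).

    Formula.  On the s-th piece, t^(-q/2) H(t) is the minimum of t^(-q/2) and
    of the power function [branch s], of exponent 1/2 + 1/s - q/2.
    Consecutive branches agree at the knots and the exponent decreases with s
    and changes sign at s_q, so that the glued branches rise up to t_(s_q) and
    fall afterwards.  The five cases record whether the maximum is reached at
    t = 1, where the two functions cross, at the peak t_(s_q), where the
    constraint h_0(t) >= 1 becomes active, or beyond n
    ([rate_case_is_max]).  The maximum is unique, so each applicable case has
    this value; the formulas for a cube are recognised as maxima in the
    same way. *)

(** * Measures with a density *)

Section density.
Context (disp : measure_display) (T : measurableType disp) (R : realType).
Variables (mu : {measure set T -> \bar R}) (Z : T -> R).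
Hypotheses (mZ : measurable_fun setT Z) (Z0 : forall x, 0 <= Z x).
Local Open Scope ereal_scope.

Lemma density_measure : exists m : {measure set T -> \bar R},
  forall A, m A = \int[mu]_(x in A) (Z x)%:E.
Proof.
pose m A := \int[mu]_(x in A) (Z x)%:E.
have m0 : m set0 = 0 by rewrite /m integral_set0.
have mge0 A : 0 <= m A by apply: integral_ge0 => x _; rewrite lee_fin.
have madd : semi_sigma_additive m.
  move=> F mF tF mUF; rewrite /m ge0_integral_bigcup//.
  - apply: is_cvg_ereal_nneg_natsum_cond => n _ _.
    by apply: integral_ge0 => x _; rewrite lee_fin.
  - by apply/measurable_EFinP; exact: measurable_funTS.
  - by move=> x _; rewrite lee_fin.
pose mm := isMeasure.Build _ _ _ m m0 mge0 madd.
pose m' : {measure set T -> \bar R} := HB.pack m mm.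
by exists m'.
Qed.

Import HBNNSimple.

(** Monotone approximation by simple functions reduces the formula to
    indicators, where it is the hypothesis on [m]. *)
Lemma ge0_integral_density (m : {measure set T -> \bar R}) (g : T -> \bar R) :
  (forall A, measurable A -> m A = \int[mu]_(x in A) (Z x)%:E) ->
  measurable_fun setT g -> (forall x, 0 <= g x) ->
  \int[m]_x g x = \int[mu]_x ((Z x)%:E * g x).
Proof.
move=> mE mg g0; pose h := nnsfun_approx measurableT mg.
have mEZ : measurable_fun [set: T] (EFin \o Z) by exact/measurable_EFinP.
have -> : \int[m]_x g x = lim (\int[m]_x (EFin \o h n) x @[n --> \oo]).
  rewrite -monotone_convergence//.
  - by apply: eq_integral => x _; apply/esym/cvg_lim => //; exact: cvg_nnsfun_approx.
  - by move=> n; apply/measurable_EFinP; exact/measurable_funP.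
  - by move=> n x _ /=; rewrite lee_fin.
  - by move=> x _ a b ab; rewrite lee_fin; exact/lefP/nd_nnsfun_approx.
have -> : \int[mu]_x ((Z x)%:E * g x) =
    lim (\int[mu]_x ((Z x)%:E * (h n x)%:E) @[n --> \oo]).
  rewrite -monotone_convergence//.
  - apply: eq_integral => x _; apply/esym/cvg_lim => //.
    by apply: cvgeZl => [//|]; apply: cvg_nnsfun_approx.
  - by move=> n; apply: emeasurable_funM => //; exact/measurable_EFinP.
  - by move=> n x _ /=; rewrite mule_ge0 ?lee_fin.
  - move=> x _ a b ab; rewrite lee_wpmul2l ?lee_fin//.
    exact/lefP/nd_nnsfun_approx.
suff suf n : \int[m]_x (EFin \o h n) x = \int[mu]_x ((Z x)%:E * (h n x)%:E).
  by under eq_fun do rewrite suf.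
have indic r : measurable_fun [set: T]
    (fun x => (r * \1_(h n @^-1` [set r]) x)%:E).
  by apply/measurable_EFinP; exact: measurable_funM.
under eq_integral do rewrite /= fimfunE -fsumEFin//.
rewrite ge0_integral_fsum//; last by move=> r x _; exact: nnfun_muleindic_ge0.
under [RHS]eq_integral => x _.
  rewrite fimfunE -fsumEFin// ge0_mule_fsumr; last first.
    by move=> r; exact: nnfun_muleindic_ge0.
  over.
rewrite ge0_integral_fsum//; last 2 first.
- by move=> r; apply: emeasurable_funM.
- by move=> r x _; rewrite mule_ge0 ?lee_fin//; exact: nnfun_muleindic_ge0.
apply: eq_fsbigr => r rh.
have r0 : (0 <= r)%R by move: rh; rewrite inE => -[t _ <-].
under eq_integral do rewrite EFinM.
rewrite ge0_integralZl//; last first.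
  by apply/measurable_EFinP.
under [RHS]eq_integral do rewrite EFinM muleCA.
rewrite ge0_integralZl//; last 2 first.
- by apply: emeasurable_funM => //; apply/measurable_EFinP.
- by move=> x _; rewrite mule_ge0 ?lee_fin.
congr (_ * _).
rewrite integral_indic// setIT mE//.
rewrite integral_mkcond; apply: eq_integral => x _.
by rewrite /= epatch_indic.
Qed.

End density.

(** * Product of expectations under independence *)

Section independence.
Context (R : realType) (disp : measure_display) (T : measurableType disp).
Variables (P : probability T R) (n : nat) (eps : 'I_n -> {RV P >-> R}).
Hypothesis ind : mutually_independent eps.
Local Open Scope ereal_scope.

(** Both sides are integrals of [g] against measures on the line, namely the
    image under [X] of the measure of density [Z] and [C] times the law of
    [X]; the hypothesis says that these measures agree. *)
Lemma ge0_integral_indep_factor (Z : T -> R) (X : {RV P >-> R}) (C : R)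
    (g : R -> R) :
  measurable_fun setT Z -> (forall w, 0 <= Z w)%R -> (0 <= C)%R ->
  (forall A, measurable A ->
    \int[P]_w (Z w * \1_A (X w))%:E = C%:E * P (X @^-1` A)) ->
  measurable_fun setT g -> (forall x, 0 <= g x)%R ->
  \int[P]_w (Z w * g (X w))%:E = C%:E * \int[P]_w (g (X w))%:E.
Proof.
move=> mZ Z0 C0 ZX mg g0.
have mEg : measurable_fun [set: R] (EFin \o g) by exact/measurable_EFinP.
have mX : measurable_fun [set: T] X by exact: measurable_funPT.
have [m mE] := density_measure P mZ Z0.
have /= <- := ge0_integral_density mZ Z0 (fun A _ => mE A)
  (measurableT_comp mEg mX) (fun w => g0 (X w)).
have := @ge0_integral_pushforward _ _ _ _ _ _ mX m setT _ measurableT mEg.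
rewrite preimage_setT => <-; last by move=> x _; rewrite lee_fin.
rewrite (eq_measure_integral (mscale (NngNum C0) (pushforward P X))); last first.
  move=> A mA _; rewrite /= /mscale /= /pushforward mE -ZX// [LHS]integral_mkcond.
  by apply: eq_integral => w _; rewrite epatch_indic/= EFinM.
rewrite ge0_integral_mscale//; last by move=> x _; rewrite lee_fin.
congr (_ * _); rewrite ge0_integral_pushforward//.
by move=> x _; rewrite lee_fin.
Qed.

Lemma prod_indic (A : 'I_n -> set R) (x : 'I_n -> R) :
  (\prod_i \1_(A i) (x i) = (`[< forall i, A i (x i) >])%:R :> R)%R.
Proof.
case: asboolP => [Ax|/existsNP[i nAx]].
  by rewrite big1// => i _; rewrite indicE mem_set.
by apply/eqP; rewrite prodf_seq_eq0; apply/hasP; exists i;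
  rewrite ?mem_index_enum//= indicE memNset.
Qed.

(** For indicators this is the definition of mutual independence.  The
    factors are then changed from indicators to the [g i] one at a time, each
    change being an instance of [ge0_integral_indep_factor].  Real constants
    [c i] make all the expectations finite. *)
Lemma ge0_integral_prod_indep (g : 'I_n -> R -> R) (c : 'I_n -> R) :
  (forall i, measurable_fun setT (g i)) -> (forall i x, 0 <= g i x)%R ->
  (forall i, \int[P]_w (g i (eps i w))%:E = (c i)%:E) ->
  \int[P]_w (\prod_i g i (eps i w))%R%:E = (\prod_i c i)%R%:E.
Proof.
move=> mg g0 gc.
(* The factors below k are already general, the others are indicators. *)
suff H k (A : 'I_n -> set R) : (forall i, measurable (A i)) -> (k <= n)%N ->
    \int[P]_w (\prod_(i < n) (if (i < k)%N then g i else \1_(A i)) (eps i w))%R%:E =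
    (\prod_(i < n)
      if (i < k)%N then c i else fine (P (eps i @^-1` A i)))%R%:E.
  have := H n (fun=> setT) (fun=> measurableT) (leqnn n) => /=.
  under eq_integral do under eq_bigr do rewrite ltn_ord.
  by move=> ->; congr EFin; apply: eq_bigr => i _; rewrite ltn_ord.
have mpre i B : measurable B -> measurable (eps i @^-1` B).
  by move=> mB; rewrite -[X in measurable X]setTI; exact: measurable_funPT.
have PE i B : measurable B -> P (eps i @^-1` B) = (fine (P (eps i @^-1` B)))%:E.
  by move=> mB; rewrite fineK// fin_num_measure//; exact: mpre.
elim: k A => [|k IH] A mA kn.
  under eq_integral do rewrite prod_indic.
  have := ind [set: 'I_n]%SET mA.
  rewrite (eq_bigr (fun i => (fine (P (eps i @^-1` A i)))%:E)); last first.
    by move=> i _; exact: PE.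
  rewrite -prodEFin (eq_bigl xpredT); last by move=> i; rewrite inE.
  move=> <-; rewrite -[X in _ = P X]setIT -integral_indic//; last first.
    by apply: fin_bigcap_measurable => // i _; exact: mpre.
  apply: eq_integral => w _; rewrite indicE; congr ((nat_of_bool _)%:R%:E).
  apply/idP/idP => [/asboolP H|/set_mem H].
    by apply/mem_set => i _; exact: H.
  by apply/asboolP => i; apply: H; rewrite /= inE.
pose k' := Ordinal kn.
pose h (i : 'I_n) : R -> R := if (i < k.+1)%N then g i else \1_(A i).
have mh i : measurable_fun setT (h i).
  by rewrite /h; case: ifP => _ //; exact: measurable_indic.
have h0 i x : (0 <= h i x)%R by rewrite /h; case: ifP => _.
have mhe i : measurable_fun setT (fun w => h i (eps i w)).
  by apply: measurableT_comp (mh i) _; exact: measurable_funPT.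
pose b (i : 'I_n) := if (i < k.+1)%N then c i else fine (P (eps i @^-1` A i)).
have b0 i : (0 <= b i)%R.
  rewrite /b; case: ifP => _; last exact: fine_ge0.
  by rewrite -lee_fin -gc integral_ge0// => w _; rewrite lee_fin.
rewrite -[LHS]/(\int[P]_w (\prod_i h i (eps i w))%R%:E) -[RHS]/((\prod_i b i)%R%:E).
rewrite (bigD1 k')//=.
under eq_integral do rewrite (bigD1 k')//= mulrC.
rewrite (ge0_integral_indep_factor (C := (\prod_(i | i != k') b i)%R)
   _ _ _ _ (mh k'))//.
- by rewrite mulrC EFinM; congr (_ * _); rewrite /h /b ltnSn gc.
- rewrite (_ : (fun _ => _) = fun w =>
    \prod_(i < n) if i != k' then h i (eps i w) else 1)%R.
    by apply: measurable_prod => i _; case: (i != k').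
  by apply/funext => w; exact: big_mkcond.
- by move=> w; apply: prodr_ge0 => i _.
- by apply: prodr_ge0 => i _.
move=> B mB.
pose A' i := if i == k' then B else A i.
have mA' i : measurable (A' i) by rewrite /A'; case: ifP.
have ik (i : 'I_n) : i != k' -> (i < k.+1)%N = (i < k)%N.
  by rewrite ltnS leq_eqVlt -(inj_eq val_inj)/= => /negbTE ->.
have := IH A' mA' (ltnW kn) => /=.
under eq_integral do rewrite (bigD1 k')//= ltnn mulrC {2}/A' eqxx.
rewrite (bigD1 k')//= ltnn {2}/A' eqxx mulrC EFinM -PE// => IHk.
under [LHS]eq_integral => w _.
  rewrite (eq_bigr (fun i : 'I_n =>
    (if (i < k)%N then g i else \1_(A' i)) (eps i w))); last first.
    by move=> i ik'; rewrite /h ik// /A' (negbTE ik').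
  over.
rewrite IHk; congr (_%:E * _); apply: eq_bigr => i ik'.
by rewrite /b ik// /A' (negbTE ik').
Qed.

End independence.

(** * Translates of a one-dimensional Gaussian law *)

Section gaussian_shift_1d.
Context (R : realType) (disp : measure_display) (T : measurableType disp).
Variables (P : probability T R) (sigma : R).
Hypothesis sigma0 : 0 < sigma.
Local Notation mu := (@lebesgue_measure R).

(** The density of N(theta, sigma^2) with respect to N(0, sigma^2). *)
Definition gauss_lik (theta z : R) : R :=
  expR ((theta * z - theta ^+ 2 / 2) / sigma ^+ 2).

Lemma gauss_lik_ge0 theta z : 0 <= gauss_lik theta z.
Proof. exact: expR_ge0. Qed.

Lemma measurable_gauss_lik theta : measurable_fun setT (gauss_lik theta).
Proof.
apply: measurableT_comp => //; apply: measurable_funM => //.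
by apply: measurable_funB => //; exact: measurable_funM.
Qed.

Lemma normal_pdf_lik theta x :
  normal_pdf theta sigma x = gauss_lik theta x * normal_pdf 0 sigma x.
Proof.
have s0 : sigma != 0 by rewrite gt_eqF.
rewrite !normal_pdfE// mulrCA; congr (_ * _).
rewrite /normal_fun /gauss_lik -expRD; congr expR.
by field.
Qed.

(** The square is again a likelihood ratio, for the mean 2 theta, up to a
    constant; this constant is therefore its expectation. *)
Lemma gauss_lik_sqr theta z :
  gauss_lik theta z ^+ 2 = expR (theta ^+ 2 / sigma ^+ 2) * gauss_lik (2 * theta) z.
Proof.
have s0 : sigma != 0 by rewrite gt_eqF.
by rewrite expr2 /gauss_lik -!expRD; congr expR; field.
Qed.

Lemma lebesgue_measureD (a : R) (A : set R) : measurable A ->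
  mu ((fun x => a + x) @^-1` A) = mu A.
Proof.
have mphi : measurable_fun [set: measurableTypeR R]
  (fun x => a + x : measurableTypeR R) by exact: measurable_funD.
pose f : {mfun measurableTypeR R >-> measurableTypeR R} :=
  HB.pack (fun x => a + x : measurableTypeR R)
    (isMeasurableFun.Build _ _ _ _ _ mphi).
have := @lebesgue_measure_unique R (pushforward mu f).
rewrite /pushforward/= => H mA; apply/esym/H => // _ [[x y]] _ <-.
rewrite [X in _ = lebesgue_measure X](_ : _ = [set` `](x - a), (y - a)]]).
  2: by apply/seteqP; split => z /=; rewrite !in_itv/= ltrBlDl lerBrDl.
rewrite !lebesgue_measure_itv/= !lte_fin ltrD2r.
by case: ifP => // _; rewrite -!EFinB; congr EFin; ring.
Qed.

(** A consequence of the translation invariance of Lebesgue measure. *)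
Lemma normal_prob_shift (theta : R) (A : set R) : measurable A ->
  normal_prob 0 sigma ((fun x => theta + x) @^-1` A) = normal_prob theta sigma A.
Proof.
move=> mA; have s0 : sigma != 0 by rewrite gt_eqF.
have mphi : measurable_fun [set: measurableTypeR R]
  (fun x => theta + x : measurableTypeR R) by exact: measurable_funD.
rewrite /normal_prob.
have -> : (\int[mu]_(x in (fun x => (theta + x)%R) @^-1` A) (normal_pdf 0 sigma x)%:E =
  \int[mu]_(x in (fun x => (theta + x)%R) @^-1` A)
    ((EFin \o normal_pdf theta sigma) \o (fun x => (theta + x)%R)) x)%E.
  apply: eq_integral => x _ /=; rewrite !normal_pdfE//; congr (_ * _)%:E.
  by rewrite /normal_fun subr0 (addrC theta) addrK.
pose f : {mfun measurableTypeR R >-> measurableTypeR R} :=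
  HB.pack (fun x => theta + x : measurableTypeR R)
    (isMeasurableFun.Build _ _ _ _ _ mphi).
rewrite -(ge0_integral_pushforward mphi)//.
- apply: (@eq_measure_integral _ _ _ _ mu (pushforward mu f)) => B mB _.
  exact: lebesgue_measureD.
- by apply/measurable_EFinP/measurable_funTS; exact: measurable_normal_pdf.
- by move=> x _; rewrite lee_fin normal_pdf_ge0.
Qed.

Variable X : {RV P >-> R}.
Hypothesis XN : distribution P X = normal_prob 0 sigma.

Lemma integral_gauss_lik theta (A : set R) : measurable A ->
  (\int[P]_w (gauss_lik theta (X w) * \1_A (X w))%:E =
   P ((fun w => (theta + X w)%R) @^-1` A))%E.
Proof.
move=> mA.
have mg : measurable_fun [set: measurableTypeR R]
    (fun z : measurableTypeR R => (gauss_lik theta z * \1_A z)%:E).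
  apply/measurable_EFinP/measurable_funM; first exact: measurable_gauss_lik.
  exact: measurable_indic.
have g0 z : (0 <= (gauss_lik theta z * \1_A z)%:E)%E.
  by rewrite lee_fin mulr_ge0 ?gauss_lik_ge0.
(* The normal law lives on the line with the sigma-algebra generated by
   half-open intervals, which has the same sets as the Borel sigma-algebra
   but another display; hence the explicit change of target. *)
have mX : measurable_fun [set: T] (X : T -> measurableTypeR R).
  have mX : measurable_fun [set: T] X by exact: measurable_funPT.
  by move=> _ B mB; exact: (mX measurableT B mB).
have /= := @ge0_integral_pushforward _ _ _ _ _ _ mX P setT _ measurableT mg
  (fun z _ => g0 z).
rewrite preimage_setT => <-.
have -> : pushforward P (X : T -> measurableTypeR R) = normal_prob 0 sigma.
  exact: XN.
rewrite (@ge0_integral_density _ _ _ mu _ (measurable_normal_pdf 0 sigma)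
  (normal_pdf_ge0 0 sigma) (normal_prob 0 sigma) _ _ mg g0)//.
transitivity (normal_prob theta sigma A).
  rewrite /normal_prob [RHS]integral_mkcond; apply: eq_integral => x _.
  by rewrite epatch_indic /= -!EFinM (normal_pdf_lik theta); congr EFin; ring.
by rewrite -normal_prob_shift// -XN.
Qed.

Lemma integral_gauss_lik_sqr theta :
  (\int[P]_w (gauss_lik theta (X w) ^+ 2)%:E = (expR (theta ^+ 2 / sigma ^+ 2))%:E)%E.
Proof.
under eq_integral do rewrite gauss_lik_sqr EFinM.
have mX : measurable_fun [set: T] X by exact: measurable_funPT.
rewrite ge0_integralZl//=; last 2 first.
- by apply/measurable_EFinP/measurableT_comp => //; exact: measurable_gauss_lik.
- by move=> w _; rewrite lee_fin gauss_lik_ge0.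
have := @integral_gauss_lik (2 * theta) setT measurableT.
rewrite preimage_setT probability_setT => e.
rewrite -[RHS]mule1 -e; congr (_ * _)%E.
by apply: eq_integral => w _; rewrite indicT mulr1.
Qed.

End gaussian_shift_1d.

(** * Translates of a Gaussian vector *)

Section gaussian_shift_nd.
Context (R : realType) (n : nat).

Definition rectangles : set (set (n.-tuple R)) :=
  [set A | exists2 F : 'I_n -> set R, (forall i, measurable (F i)) &
    A = [set y | forall i, F i (tnth y i)]].

Lemma measurable_rectangle A : rectangles A -> measurable A.
Proof.
move=> [F mF ->].
have -> : [set y : n.-tuple R | forall i, F i (tnth y i)] =
    \bigcap_(i in [set: 'I_n]) ((fun y => tnth y i) @^-1` F i).
  by apply/seteqP; split => y /= H i; [move=> _|]; exact: H.
apply: fin_bigcap_measurable => // i _; rewrite -[X in measurable X]setTI.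
by apply: measurable_tnth.
Qed.

Lemma measurable_tupleE :
  @measurable _ (n.-tuple R) = <<s rectangles >>.
Proof.
apply/seteqP; split; last first.
  apply: smallest_sub; first exact: sigma_algebra_measurable.
  exact: measurable_rectangle.
apply: smallest_sub; first exact: smallest_sigma_algebra.
move=> A; rewrite -bigcup_seq => -[i _ [B mB <-]].
rewrite setTI; apply: sub_sigma_algebra.
exists (fun j => if j == i then B else setT); first by move=> j; case: ifP.
apply/seteqP; split => y /= H; last by have := H i; rewrite eqxx.
by move=> j; case: eqP => [->|].
Qed.

Lemma setI_closed_rectangles : setI_closed rectangles.
Proof.
move=> A B [F mF ->] [G mG ->].
exists (fun i => F i `&` G i); first by move=> i; exact: measurableI.
apply/seteqP; split => y /=; first by move=> [HF HG] i; split.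
by move=> H; split => i; case: (H i).
Qed.

Lemma rectanglesT : rectangles setT.
Proof. by exists (fun=> setT) => //; apply/seteqP; split. Qed.

Context (disp : measure_display) (T : measurableType disp).
Variables (P : probability T R) (eps : 'I_n -> {RV P >-> R}) (sigma : R).
Hypotheses (sigma0 : 0 < sigma) (epsN : iid_gaussian eps sigma).

Lemma measurable_noise (theta : 'I_n -> R) :
  measurable_fun setT (fun w => [tuple theta i + eps i w | i < n]).
Proof.
apply/measurable_fun_tnthP => i.
rewrite (_ : _ \o _ = fun w => theta i + eps i w); last first.
  by apply/funext => w /=; rewrite tnth_mktuple.
by apply: measurable_funD => //; exact: measurable_funPT.
Qed.

Let eps0 w : n.-tuple R := [tuple eps i w | i < n].

Let meps0 : measurable_fun setT eps0.
Proof.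
apply/measurable_fun_tnthP => i.
rewrite (_ : _ \o _ = fun w => eps i w); last first.
  by apply/funext => w /=; rewrite tnth_mktuple.
exact: measurable_funPT.
Qed.

Definition gauss_lik_prod (theta : 'I_n -> R) (w : T) : R :=
  \prod_i gauss_lik sigma (theta i) (eps i w).

Lemma gauss_lik_prod_ge0 theta w : 0 <= gauss_lik_prod theta w.
Proof. by apply: prodr_ge0 => i _; exact: gauss_lik_ge0. Qed.

Lemma measurable_gauss_lik_prod theta :
  measurable_fun setT (gauss_lik_prod theta).
Proof.
apply: measurable_prod => i _.
apply: measurableT_comp; first exact: measurable_gauss_lik.
exact: measurable_funPT.
Qed.

(** Both sides are finite measures in [B], so it is enough to compare them on
    rectangles, where each is a product over the coordinates. *)
Lemma gauss_shift_law (theta : 'I_n -> R) (B : set (n.-tuple R)) :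
  measurable B ->
  (P ((fun w => [tuple (theta i + eps i w)%R | i < n]) @^-1` B) =
   \int[P]_(w in eps0 @^-1` B) (gauss_lik_prod theta w)%:E)%E.
Proof.
move=> mB.
have [m mE] := density_measure P (measurable_gauss_lik_prod theta)
  (gauss_lik_prod_ge0 theta).
rewrite -mE.
pose shifted w := [tuple (theta i + eps i w)%R | i < n].
pose f : {mfun T >-> n.-tuple R} := HB.pack shifted
  (isMeasurableFun.Build _ _ _ _ _ (measurable_noise theta)).
pose g : {mfun T >-> n.-tuple R} := HB.pack eps0
  (isMeasurableFun.Build _ _ _ _ _ meps0).
apply: (@measure_unique _ R (n.-tuple R) rectangles (fun=> setT)
  measurable_tupleE setI_closed_rectangles _ _ (pushforward P f)
  (pushforward m g)) => //.
- by move=> _; exact: rectanglesT.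
- by apply/seteqP; split => // y _; exists 0%N.
- move=> A rA; case: (rA) => F mF AE; rewrite /= /pushforward /= mE.
  rewrite [RHS](_ : _ = \int[P]_w (\prod_i (gauss_lik sigma (theta i) (eps i w) *
        \1_(F i) (eps i w)))%R%:E)%E; last first.
    rewrite integral_mkcond; apply: eq_integral => w _.
    rewrite epatch_indic /= -EFinM big_split/= prod_indic indicE.
    congr (_ * (nat_of_bool _)%:R)%:E; rewrite AE.
    apply/idP/idP => [/set_mem H|/asboolP H].
      by apply/asboolP => i; have := H i; rewrite tnth_mktuple.
    by apply/mem_set => i; rewrite /= tnth_mktuple.
  have [ind epsd] := epsN.
  have mpre i (C : set R) : measurable C ->
      measurable ((fun w => (theta i + eps i w)%R) @^-1` C).
    move=> mC; rewrite -[X in measurable X]setTI.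
    have me : measurable_fun [set: T] (fun w => (theta i + eps i w)%R).
      by apply: measurable_funD => //; exact: measurable_funPT.
    exact: me.
  rewrite (ge0_integral_prod_indep ind (c := fun i =>
      fine (P ((fun w => (theta i + eps i w)%R) @^-1` F i)))
    (g := fun i z => gauss_lik sigma (theta i) z * \1_(F i) z)); first last.
  + move=> i; rewrite (integral_gauss_lik sigma0 (epsd i))// fineK//.
    by rewrite fin_num_measure//; exact: mpre.
  + by move=> i x; rewrite mulr_ge0 ?gauss_lik_ge0.
  + move=> i; apply: measurable_funM; first exact: measurable_gauss_lik.
    exact: measurable_indic.
  have := ind [set: 'I_n]%SET (fun i => (fun z => theta i + z) @^-1` F i) _.
  rewrite (eq_bigr (fun i =>
    (fine (P ((fun w => theta i + eps i w)%R @^-1` F i)))%:E)); last first.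
    by move=> i _; rewrite fineK// fin_num_measure//; exact: mpre.
  rewrite -prodEFin (eq_bigl xpredT); last by move=> i; rewrite inE.
  move=> <-.
    congr (P _); rewrite AE; apply/seteqP; split => w /=.
      by move=> H i _ /=; have := H i; rewrite tnth_mktuple.
    by move=> H i; rewrite tnth_mktuple; apply: H; rewrite /= inE.
  move=> i; rewrite -[X in measurable X]setTI.
  have me : measurable_fun [set: R] (fun z => (theta i + z)%R).
    exact: measurable_funD.
  exact: me.
- by move=> k; rewrite /= /pushforward preimage_setT probability_setT ltry.
Qed.

Lemma integral_gauss_lik_prod_sqr theta :
  (\int[P]_w (gauss_lik_prod theta w ^+ 2)%:E =
   (expR ((\sum_i theta i ^+ 2) / sigma ^+ 2))%:E)%E.
Proof.
have [ind epsd] := epsN.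
under eq_integral do rewrite /gauss_lik_prod -prodrXl.
rewrite (ge0_integral_prod_indep ind
  (c := fun i => expR (theta i ^+ 2 / sigma ^+ 2))
  (g := fun i z => gauss_lik sigma (theta i) z ^+ 2)).
- by rewrite mulr_suml expR_sum.
- by move=> i; apply: measurable_funX; exact: measurable_gauss_lik.
- by move=> i x; exact: sqr_ge0.
- by move=> i; exact: integral_gauss_lik_sqr.
Qed.

(** With [L] the likelihood ratio, [L] is at most [1 + L ^+ 2 / 4] on [B];
    integrate.  This one-sided bound replaces a bound on the total variation
    distance, and needs only the second moment of [L]. *)
Lemma gauss_shift_bound (theta : 'I_n -> R) (B : set (n.-tuple R)) :
  measurable B ->
  (P ((fun w => [tuple (theta i + eps i w)%R | i < n]) @^-1` B) <=
   P (eps0 @^-1` B) +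
   (4^-1 * expR ((\sum_i theta i ^+ 2) / sigma ^+ 2))%:E)%E.
Proof.
move=> mB; rewrite gauss_shift_law// EFinM -integral_gauss_lik_prod_sqr.
have mpre : measurable (eps0 @^-1` B).
  by rewrite -[X in measurable X]setTI; exact: meps0.
have mL := measurable_gauss_lik_prod theta.
have mL2 : measurable_fun [set: T] (fun w => (gauss_lik_prod theta w ^+ 2)%:E).
  by apply/measurable_EFinP; exact: measurable_funX.
rewrite -ge0_integralZl//; last by move=> w _; rewrite lee_fin sqr_ge0.
rewrite -[X in (_ <= P X + _)%E]setIT -integral_indic//.
rewrite -ge0_integralD//; first last.
- by apply: emeasurable_funM.
- by move=> w _; rewrite mule_ge0 ?lee_fin ?sqr_ge0.
- by apply/measurable_EFinP; exact: measurable_indic.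
rewrite [leLHS]integral_mkcond; apply: ge0_le_integral => //.
- by move=> w _; rewrite erestrict_ge0// => x _; rewrite lee_fin gauss_lik_prod_ge0.
- apply/(measurable_restrictT _ _).1 => //.
  by apply/measurable_funTS/measurable_EFinP.
- apply: emeasurable_funD; first by apply/measurable_EFinP; exact: measurable_indic.
  exact: emeasurable_funM.
move=> w _; rewrite epatch_indic/= -!EFinM -EFinD lee_fin.
have := gauss_lik_prod_ge0 theta w; set L := gauss_lik_prod theta w => L0.
rewrite indicE; case: (w \in _) => /=; rewrite ?mulr1 ?mulr0.
  rewrite -subr_ge0 (_ : _ - _ = 4^-1 * (L - 2) ^+ 2); last by field.
  by rewrite mulr_ge0 ?sqr_ge0.
by rewrite add0r mulr_ge0 ?sqr_ge0.
Qed.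

End gaussian_shift_nd.

(** * Testing two means, and Assouad's method *)

Section assouad.
Context (R : realType) (disp : measure_display) (T : measurableType disp).
Variables (P : probability T R) (n : nat) (eps : 'I_n -> {RV P >-> R}).
Variable sigma : R.
Hypotheses (sigma0 : 0 < sigma) (epsN : iid_gaussian eps sigma).
Variable q : R.
Hypothesis q0 : 0 <= q.

Lemma measurable_preimage_observation (fn : n.-tuple R) (B : set (n.-tuple R)) :
  measurable B -> measurable (observation eps fn @^-1` B).
Proof.
move=> mB; rewrite -[X in measurable X]setTI.
exact: (@measurable_noise _ _ _ _ P eps (tnth fn)).
Qed.

(** [gauss_shift_bound] at squared distance sigma^2 / 4, where
    exp(1/4) / 4 <= 1/3. *)
Lemma observation_shift_bound (u v : n.-tuple R) (B : set (n.-tuple R)) :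
  measurable B -> \sum_i (tnth v i - tnth u i) ^+ 2 <= sigma ^+ 2 / 4 ->
  (P (observation eps v @^-1` B) <=
   P (observation eps u @^-1` B) + (3^-1)%:E)%E.
Proof.
move=> mB uv.
pose tr (y : n.-tuple R) := [tuple tnth u i + tnth y i | i < n].
have mtr : measurable_fun setT tr.
  apply/measurable_fun_tnthP => i.
  rewrite (_ : _ \o _ = fun y => tnth u i + tnth y i); last first.
    by apply/funext => w /=; rewrite tnth_mktuple.
  by apply: measurable_funD => //; exact: measurable_tnth.
have mB' : measurable (tr @^-1` B).
  by rewrite -[X in measurable X]setTI; exact: mtr.
have := gauss_shift_bound sigma0 epsN (fun i => tnth v i - tnth u i) mB'.
have -> : (fun w => [tuple (tnth v i - tnth u i + eps i w)%R | i < n]) @^-1`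
    (tr @^-1` B) = observation eps v @^-1` B.
  apply/seteqP; split => w /=; congr B; apply: eq_from_tnth => i;
  by rewrite !tnth_mktuple; ring.
have -> : (fun w => [tuple eps i w | i < n]) @^-1` (tr @^-1` B) =
    observation eps u @^-1` B.
  by apply/seteqP; split => w /=; congr B; apply: eq_from_tnth => i;
  rewrite !tnth_mktuple.
move/le_trans; apply; rewrite leeD2l// lee_fin.
set s := _ / sigma ^+ 2.
have s4 : s <= 4^-1 by rewrite ler_pdivrMr ?exprn_gt0// mulrC.
(* exp(-1/4) >= 3/4, hence exp(1/4) <= 4/3. *)
have e34 : 3 / 4 <= expR (- s).
  by apply: le_trans (expR_ge1Dx _); lra.
have es := expR_gt0 s.
have : expR s * expR (- s) = 1 by rewrite -expRD subrr expR0.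
nra.
Qed.

Lemma le_expectation_event (X : T -> R) (k : R) (S : set T) :
  measurable S -> measurable_fun setT X -> (forall w, 0 <= X w) -> 0 <= k ->
  (forall w, S w -> k <= X w) -> (k%:E * P S <= 'E_P[X])%E.
Proof.
move=> mS mX X0 k0 kX; rewrite unlock.
rewrite -[X in (_ * P X)%E]setIT -integral_indic// -ge0_integralZl//.
  apply: ge0_le_integral => //.
  - by move=> w _; rewrite -EFinM lee_fin mulr_ge0.
  - apply: emeasurable_funM => //; apply/measurable_EFinP.
    exact: measurable_indic.
  - exact/measurable_EFinP.
  move=> w _; rewrite -EFinM lee_fin indicE.
  by case: (boolP (w \in S)) => [/set_mem /kX|_]; rewrite ?mulr1 ?mulr0.
by apply/measurable_EFinP; exact: measurable_indic.
Qed.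

(** An estimate at distance less than delta / 2 from one of the two values is
    at distance at least delta / 2 from the other.  The probabilities of the
    two errors of the resulting test add up to at least 2/3. *)
Lemma two_point_risk (fhat : n.-tuple R -> n.-tuple R) (u v : n.-tuple R)
    (i : 'I_n) (delta : R) :
  measurable_fun setT fhat -> 0 <= delta ->
  delta <= `|tnth u i - tnth v i| ->
  \sum_j (tnth v j - tnth u j) ^+ 2 <= sigma ^+ 2 / 4 ->
  ((2 / 3 * (delta / 2) `^ q)%:E <=
   'E_P[fun w => (`|tnth (fhat (observation eps u w)) i - tnth u i| `^ q)%R] +
   'E_P[fun w => (`|tnth (fhat (observation eps v w)) i - tnth v i| `^ q)%R])%E.
Proof.
move=> mf d0 duv uv.
pose B := [set y : n.-tuple R | delta / 2 <= `|tnth (fhat y) i - tnth u i|].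
have mg c : measurable_fun [set: n.-tuple R] (fun y => `|tnth (fhat y) i - c|).
  apply: measurableT_comp => //; apply: measurable_funB => //.
  apply: (measurableT_comp (f := fun x => tnth x i)) => //.
  exact: measurable_tnth.
have mB : measurable B.
  have -> : B = [set: _] `&` (fun y => `|tnth (fhat y) i - tnth u i|) @^-1`
      `[delta / 2, +oo[%classic.
    by rewrite setTI; apply/seteqP; split => y /=; rewrite in_itv/= andbT.
  exact: mg.
have mX (t : n.-tuple R) : measurable_fun [set: T]
    (fun w => `|tnth (fhat (observation eps t w)) i - tnth t i| `^ q).
  apply: (measurableT_comp (measurable_powR q)).
  apply: (measurableT_comp (mg _)).
  exact: (@measurable_noise _ _ _ _ P eps (tnth t)).
have k0 : 0 <= (delta / 2) `^ q by exact: powR_ge0.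
have d20 : 0 <= delta / 2 by rewrite divr_ge0.
have mBu := measurable_preimage_observation u mB.
have mBv := measurable_preimage_observation v mB.
have Hu := le_expectation_event mBu (mX u) (fun w => powR_ge0 _ _) k0.
have Hv := le_expectation_event (measurableC mBv) (mX v)
  (fun w => powR_ge0 _ _) k0.
apply: le_trans; last apply: leeD.
2: apply: Hu => w; rewrite /B /= => h; exact: ge0_ler_powR.
2: { apply: Hv => w; rewrite /B /= => /negP; rewrite -ltNge => h.
  apply: ge0_ler_powR => //; rewrite ?nnegrE//.
  move: h; set z := tnth (fhat _) i => h.
  have := ler_distD z (tnth u i) (tnth v i).
  by rewrite (distrC (tnth u i) z); lra. }
rewrite probability_setC// -ge0_muleDr ?measure_ge0// ?sube_ge0
  ?probability_le1// ?orbT//.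
have := observation_shift_bound mB uv.
rewrite -(fineK (fin_num_measure P _ mBu)) -(fineK (fin_num_measure P _ mBv)).
rewrite -EFinD lee_fin => h.
rewrite -EFinB -EFinD -EFinM lee_fin mulrC ler_wpM2l//; lra.
Qed.

(** The supremum of the risk dominates its average over [E].  For a fixed
    coordinate [i] in [W], pairing each [e] with [flip i e] reduces the
    average to [two_point_risk]. *)
Lemma assouad (E : finType) (e0 : E) (th : E -> n.-tuple R)
    (flip : 'I_n -> E -> E) (W : {set 'I_n}) (delta : R)
    (F : set (n.-tuple R)) :
  0 <= delta -> (forall e, F (th e)) ->
  (forall i, i \in W -> involutive (flip i)) ->
  (forall i e, i \in W ->
     delta <= `|tnth (th e) i - tnth (th (flip i e)) i|) ->
  (forall i e, i \in W ->
     \sum_j (tnth (th (flip i e)) j - tnth (th e) j) ^+ 2 <= sigma ^+ 2 / 4) ->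
  ((#|W|%:R / n%:R * ((delta / 2) `^ q / 3))%:E <= minimax_risk eps q F)%E.
Proof.
move=> d0 Fth inv sep close; apply: le_ereal_inf_tmp => _ [fhat /= mf <-].
set S := ereal_sup _.
have rS e : (risk eps q fhat (th e) <= S)%E.
  by apply: ereal_sup_ubound; exists (th e).
have E0 : (0 < #|E|)%N by apply/card_gt0P; exists e0.
pose X e i := ('E_P[fun w =>
  (`|tnth (fhat (observation eps (th e) w)) i - tnth (th e) i| `^ q)%R])%E.
have X0 e i : (0 <= X e i)%E.
  by apply: expectation_ge0 => w; exact: powR_ge0.
have pair i : i \in W ->
    ((#|E|%:R * ((delta / 2) `^ q / 3))%:E <= \sum_e X e i)%E.
  move=> iW.
  have : ((\sum_(e : E) (2 / 3 * (delta / 2) `^ q))%:E <=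
      \sum_e X e i + \sum_e X e i)%E.
    rewrite [X in (_ <= _ + X)%E](reindex_inj (inv_inj (inv i iW)))/=.
    rewrite -big_split/= -sumEFin; apply: lee_sum => e _.
    by apply: two_point_risk => //; [exact: sep|exact: close].
  rewrite sumr_const cardT -cardE.
  case: (\sum_e X e i)%E => [s| |] //=; rewrite -?EFinD ?lee_fin ?leey//.
  by rewrite -mulr_natl; lra.
have sumS : (\sum_e risk eps q fhat (th e) <= #|E|%:R%:E * S)%E.
  apply: (@le_trans _ _ (\sum_(e : E) S)%E).
    by apply: lee_sum => e _; exact: rS.
  by rewrite sumr_const mule_natl.
have lowS : ((#|E|%:R * (#|W|%:R / n%:R * ((delta / 2) `^ q / 3)))%:E <=
    \sum_e risk eps q fhat (th e))%E.
  rewrite /risk -ge0_sume_distrr; last first.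
    by move=> e _; apply: sume_ge0 => i _; exact: X0.
  rewrite exchange_big/=.
  apply: (@le_trans _ _ ((n%:R^-1)%:E * \sum_(i in W)
     (#|E|%:R * ((delta / 2) `^ q / 3))%:E)%E).
    rewrite sumEFin sumr_const -EFinM lee_fin -mulr_natl.
    by rewrite le_eqVlt; apply/orP; left; apply/eqP; ring.
  apply: lee_wpmul2l; first by rewrite lee_fin invr_ge0.
  rewrite [leRHS](bigID (mem W))/= -[leLHS]adde0; apply: leeD.
    by apply: lee_sum => i; exact: pair.
  by apply: sume_ge0 => i _; apply: sume_ge0 => e _; exact: X0.
have := le_trans lowS sumS.
rewrite EFinM lee_pmul2l//; by rewrite ?lte_fin ?ltr0n.
Qed.

End assouad.

(** * Ladders of boxes in the lattice *)

Section block_design.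
Context (R : realType) (d : nat) (ns : d.-tuple nat).
Variables (x : 'I_(npts ns) -> d.-tuple nat).
Hypothesis ns_ge1 : forall j : 'I_d, (1 <= tnth ns j)%N.
Hypothesis x_bij : set_bij [set: 'I_(npts ns)] (lattice ns) x.
Variables (sigma Delta : R).
Hypotheses (sigma0 : 0 < sigma).
Context (disp : measure_display) (T : measurableType disp).
Variables (P : probability T R) (eps : 'I_(npts ns) -> {RV P >-> R}).
Hypothesis epsN : iid_gaussian eps sigma.
Variable q : R.
Hypothesis q0 : 0 <= q.

Let xL i : lattice ns (x i).
Proof. by case: x_bij => xfun _ _; exact: xfun. Qed.

Let x_inj : injective x.
Proof. by case: x_bij => _ + _ => xi i j; apply: xi; rewrite inE. Qed.

Lemma npts_gt0 : (0 < npts ns)%N.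
Proof. by rewrite prodn_gt0// => j; exact: ns_ge1. Qed.

Variable a : 'I_d -> nat.
Hypothesis a_gt0 : forall j, (0 < a j)%N.

Let N := (\sum_(j < d) (tnth ns j + a j))%N.

Definition block_coord (v : d.-tuple nat) (j : 'I_d) : nat :=
  ((tnth v j).-1 %/ a j)%N.

(** The box of [v], as an element of a finite type so that sets of boxes can
    be enumerated; [N] exceeds every box coordinate of a lattice point. *)
Definition block (v : d.-tuple nat) : {ffun 'I_d -> 'I_N.+1} :=
  [ffun j => inord (block_coord v j)].

Definition level (v : d.-tuple nat) : nat := (\sum_(j < d) block_coord v j)%N.

Let side_le_N j : (tnth ns j + a j <= N)%N.
Proof. by rewrite /N (bigD1 j)//= leq_addr. Qed.

Lemma block_coord_lattice u v : lattice ns u -> lattice ns v ->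
  block u = block v -> forall j, block_coord u j = block_coord v j.
Proof.
move=> Lu Lv uv j.
have lt w : lattice ns w -> (block_coord w j < N.+1)%N.
  move=> /(_ j)/andP[_ wj]; rewrite ltnS (leq_trans (leq_div _ _))//.
  rewrite (leq_trans (leq_pred _))// (leq_trans wj)//.
  by rewrite (leq_trans _ (side_le_N j)) ?leq_addr.
have := congr1 (fun f : {ffun 'I_d -> 'I_N.+1} => val (f j)) uv.
by rewrite !ffunE /= !inordK ?lt.
Qed.

(** Within a box, a point is determined by the remainders of its coordinates
    modulo the sides of the box. *)
Lemma card_block i :
  (#|[set j | block (x j) == block (x i)]%SET| <= \prod_(l < d) a l)%N.
Proof.
pose res (v : d.-tuple nat) : {ffun 'I_d -> 'I_N.+1} :=
  [ffun l => inord ((tnth v l).-1 %% a l)%N].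
have ltr v l : ((tnth v l).-1 %% a l < N.+1)%N.
  rewrite ltnS (leq_trans (ltnW (ltn_pmod _ (a_gt0 l))))//.
  by rewrite (leq_trans _ (side_le_N l)) ?leq_addl.
pose D := [set j | block (x j) == block (x i)]%SET.
have res_inj : {in D &, injective (res \o x)}.
  move=> j k; rewrite !inE => /eqP bj /eqP bk /= rjk; apply: x_inj.
  apply: eq_from_tnth => l.
  have bjk := block_coord_lattice (xL j) (xL k) (etrans bj (esym bk)) l.
  have := congr1 (fun f : {ffun 'I_d -> 'I_N.+1} => val (f l)) rjk.
  rewrite !ffunE /= !inordK ?ltr// => mjk.
  have := divn_eq (tnth (x j) l).-1 (a l).
  rewrite -/(block_coord (x j) l) bjk mjk /block_coord -divn_eq => pjk.
  have /andP[j1 _] := xL j l; have /andP[k1 _] := xL k l.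
  by rewrite -(prednK j1) -(prednK k1) pjk.
rewrite -(card_in_imset res_inj).
pose F l := [pred r : 'I_N.+1 | (r < a l)%N].
have sub : ((res \o x) @: D)%SET \subset family F.
  apply/fintype.subsetP => _ /finset.imsetP[j _ ->]; apply/familyP => l.
  by rewrite inE /= ffunE inordK ?ltr// ltn_pmod.
apply: leq_trans (subset_leq_card sub) _.
rewrite card_family foldrE big_map big_enum/=.
apply: leq_prod => l _.
have aN : (a l <= N.+1)%N.
  by rewrite ltnW// ltnS (leq_trans _ (side_le_N l)) ?leq_addl.
have wi : injective (widen_ord aN) by move=> u v /(congr1 val)/= /val_inj.
rewrite -[leqRHS]card_ord -(card_imset _ wi).
apply/subset_leq_card/fintype.subsetP => r rF.
have ra : (r < a l)%N by exact: rF.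
by apply/finset.imsetP; exists (Ordinal ra) => //; exact: val_inj.
Qed.

Variables (k m : nat) (delta : R).
Hypotheses (k_gt0 : (0 < k)%N) (delta0 : 0 <= delta).

(** Outside the [m]-th window of [k] levels the height is frozen at [0] below
    and at [k] above, which bounds the total range by [k]. *)
Definition ladder_height (e : {ffun {ffun 'I_d -> 'I_N.+1} -> bool})
    (v : d.-tuple nat) : nat :=
  if (level v %/ k < m)%N then 0%N
  else if (level v %/ k == m)%N then (level v %% k + e (block v))%N else k.

Definition ladder e v : R := delta * (ladder_height e v)%:R.

Lemma ladder_height_le e v : (ladder_height e v <= k)%N.
Proof.
rewrite /ladder_height; case: ifP => // _; case: ifP => // _.
have := ltn_pmod (level v) k_gt0.
by case: (e _); rewrite ?addn1 ?addn0 // => /ltnW.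
Qed.

(** Along a coordinate direction no box coordinate decreases, hence either
    the level increases, and the climb makes up for raising the lower box, or
    the box does not change. *)
Lemma ladder_nondecreasing e : coord_nondecreasing ns (ladder e).
Proof.
move=> u v j Lu Lv uv uvj; rewrite ler_wpM2l// ler_nat.
have bc l : (block_coord u l <= block_coord v l)%N.
  rewrite /block_coord; have [->|lj] := eqVneq l j; last by rewrite uv.
  by rewrite leq_div2r// -!subn1 leq_sub2r.
have le_lev : (level u <= level v)%N by exact: leq_sum.
have le_div : (level u %/ k <= level v %/ k)%N by rewrite leq_div2r.
rewrite {1}/ladder_height; case: ltnP => // mu.
have mv := leq_trans mu le_div.
rewrite {1}/ladder_height [in leqRHS]ltnNge mv /=.
case: eqP => [um|un]; case: eqP => [vm|vn] //.
- move: le_lev; rewrite leq_eqVlt => /predU1P[levE|lt_lev].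
    (* Equal sums of ordered families have equal terms: same box. *)
    have -> : block u = block v; last by rewrite levE.
    have bE l : block_coord u l = block_coord v l.
      apply/eqP; move: levE => /eqP.
      rewrite -[_ == _]/(_ == level v).
      have [_ ->] := leqif_sum (I := 'I_d) (P := xpredT)
        (E1 := block_coord u) (E2 := block_coord v)
        (C := fun l => block_coord u l == block_coord v l)
        (fun l _ => leqif_eq (bc l)).
      by move/forallP => /(_ l).
    by apply/ffunP => l; rewrite !ffunE bE.
  have lt_mod : (level u %% k < level v %% k)%N.
    move: lt_lev; rewrite {1}(divn_eq (level u) k) {1}(divn_eq (level v) k).
    by rewrite um vm ltn_add2l.
  rewrite (leq_trans _ (leq_addr _ _))//; apply: leq_trans lt_mod.
  by case: (e _); rewrite ?addn1 ?addn0.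
- have := ltn_pmod (level u) k_gt0.
  by case: (e _); rewrite ?addn1 ?addn0 // => /ltnW.
- by move: le_div; rewrite vm; case: ltngtP mu un => // ->.
Qed.

Lemma ladder_range e : k%:R * delta <= sigma * Delta ->
  total_range ns sigma (ladder e) <= Delta.
Proof.
move=> kD; rewrite /total_range ler_pdivrMr// [leRHS]mulrC.
apply: le_trans kD; rewrite mulrC /ladder -mulrBr ler_wpM2l// lerBlDr.
by rewrite (@le_trans _ _ k%:R) ?ler_nat ?ladder_height_le// lerDl.
Qed.

Definition flip_block (i : 'I_(npts ns))
    (e : {ffun {ffun 'I_d -> 'I_N.+1} -> bool}) :=
  [ffun b => if b == block (x i) then ~~ e b else e b].

Lemma flip_blockK i : involutive (flip_block i).
Proof.
by move=> e; apply/ffunP => b; rewrite !ffunE; case: eqP => // _; rewrite negbK.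
Qed.

Definition window := [set i | (level (x i) %/ k == m)%N]%SET.

Lemma ladder_flip i e : i \in window ->
  `|ladder e (x i) - ladder (flip_block i e) (x i)| = delta.
Proof.
rewrite inE => im; rewrite /ladder /ladder_height im (eqP im) ltnn ffunE eqxx.
rewrite -mulrBr normrM (ger0_norm delta0) !natrD opprD addrACA subrr add0r.
by case: (e _); rewrite ?subr0 ?sub0r ?normrN normr1 mulr1.
Qed.

Lemma ladder_flip_dist i e :
  \sum_j (ladder (flip_block i e) (x j) - ladder e (x j)) ^+ 2 <=
    delta ^+ 2 * (\prod_l a l)%:R.
Proof.
pose D := [set j | block (x j) == block (x i)]%SET.
apply: (@le_trans _ _ (\sum_(j in D) delta ^+ 2)).
  rewrite [leRHS]big_mkcond/=; apply: ler_sum => j _; rewrite inE.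
  rewrite /ladder /ladder_height ffunE.
  case: ifP => _; first by rewrite subrr expr0n; case: ifP => _ //; exact: sqr_ge0.
  case: (block (x j) == block (x i)); last by rewrite subrr expr0n.
  case: ifP => _; last by rewrite subrr expr0n sqr_ge0.
  rewrite -mulrBr exprMn ler_piMr ?sqr_ge0//.
  rewrite !natrD opprD addrACA subrr add0r.
  by case: (e _); rewrite ?subr0 ?sub0r ?sqrrN expr1n.
rewrite sumr_const -[leLHS]mulr_natr ler_wpM2l ?sqr_ge0// ler_nat.
exact: card_block.
Qed.

(** The hypotheses are the two budgets: the total range of a ladder, and the
    Euclidean distance between two ladders that differ in one box. *)
Lemma window_lower_bound :
  k%:R * delta <= sigma * Delta ->
  delta ^+ 2 * (\prod_l a l)%:R <= sigma ^+ 2 / 4 ->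
  ((#|window|%:R / (npts ns)%:R * ((delta / 2) `^ q / 3))%:E <=
   minimax_risk eps q (monotone_class x sigma Delta))%E.
Proof.
move=> kD dW.
apply: (assouad sigma0 epsN q0 (E := {ffun {ffun 'I_d -> 'I_N.+1} -> bool})
  [ffun=> false] (th := fun e => value_vector x (ladder e))
  (flip := flip_block)) => //.
- move=> e; exists (ladder e) => //; split; first exact: ladder_nondecreasing.
  exact: ladder_range.
- by move=> i _; exact: flip_blockK.
- by move=> i e iW; rewrite !tnth_mktuple ladder_flip.
- move=> i e _; under eq_bigr do rewrite !tnth_mktuple.
  exact: le_trans (ladder_flip_dist _ _) dW.
Qed.

End block_design.

(** * Lower bounds at each scale *)

Section rate_lower_bound.
Context (R : realType) (d : nat) (ns : d.-tuple nat).
Variables (x : 'I_(npts ns) -> d.-tuple nat).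
Hypothesis ns_noninc :
  forall i j : 'I_d, (i <= j)%N -> (tnth ns j <= tnth ns i)%N.
Hypothesis ns_ge1 : forall j : 'I_d, (1 <= tnth ns j)%N.
Hypothesis x_bij : set_bij [set: 'I_(npts ns)] (lattice ns) x.
Variables (sigma Delta : R).
Hypotheses (sigma0 : 0 < sigma) (Delta0 : 0 <= Delta).
Context (disp : measure_display) (T : measurableType disp).
Variables (P : probability T R) (eps : 'I_(npts ns) -> {RV P >-> R}).
Hypothesis epsN : iid_gaussian eps sigma.
Variable q : R.
Hypothesis q0 : 0 <= q.

(** Here 4^(-q) comes from the amplitude delta / 2 = sigma / (4 sqrt t), the
    factor 1/3 from [assouad], and 4 d + 1 from the number of windows, as
    there are at most 2 d l + 1 levels and k >= h_0(t) / 2. *)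
Definition lower_const (d' : nat) : R := 4^-1 `^ q / (3 * (4 * d'%:R + 1)).

Lemma lower_const_gt0 d' : 0 < lower_const d'.
Proof.
by rewrite /lower_const divr_gt0// ?powR_gt0// mulr_gt0// ltr_wpDl// mulr_ge0.
Qed.

Lemma sqrt_inv_powR (t : R) : 0 <= t -> (Num.sqrt t)^-1 `^ q = t `^ (- q / 2).
Proof.
move=> t0; rewrite -(powR_inv1 (sqrtr_ge0 t)) -powR12_sqrt// -!powRrM.
by congr (_ `^ _); field.
Qed.

Lemma amplitude_powR (t : R) : 0 < t ->
  (sigma / (2 * Num.sqrt t) / 2) `^ q =
  4^-1 `^ q * (sigma `^ q * t `^ (- q / 2)).
Proof.
move=> t0; rewrite -sqrt_inv_powR ?ltW//.
have st : Num.sqrt t != 0 by rewrite gt_eqF// sqrtr_gt0.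
rewrite -!powRM ?mulr_ge0 ?invr_ge0 ?sqrtr_ge0// ?ltW//.
by congr (_ `^ _); field.
Qed.

(** Pigeonhole over the windows, of which there are at most [L %/ k + 1]. *)
Lemma heavy_window (a : 'I_d -> nat) (k L : nat) :
  (0 < k)%N -> (forall i, (level a (x i) <= L)%N) ->
  exists m, (npts ns <= (L %/ k).+1 * #|window x a k m|)%N.
Proof.
move=> k0 levL.
pose f (m : 'I_(L %/ k).+1) := #|window x a k m|.
exists [arg max_(m > ord0) f m].
case: arg_maxnP => //= m0 _ maxf.
have nE : npts ns = (\sum_(m < (L %/ k).+1) f m)%N.
  rewrite -[LHS]card_ord -sum1_card.
  rewrite (partition_big (fun i =>
    inord (level a (x i) %/ k) : 'I_(L %/ k).+1) xpredT)//=.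
  apply: eq_bigr => m _; rewrite sum1dep_card; apply: eq_card => i.
  rewrite !inE -(inj_eq val_inj)/= inordK// ltnS.
  exact: leq_div2r.
apply: (@leq_trans (\sum_(m < (L %/ k).+1) f m0)%N).
  by rewrite nE; apply: leq_sum => m _; exact: maxf.
by rewrite sum_nat_const card_ord.
Qed.

(** With amplitude sigma / (2 sqrt t), boxes of at most [t] points satisfy the
    Euclidean budget of [window_lower_bound]. *)
Lemma block_lower_bound (a : 'I_d -> nat) (t : R) (k L : nat) :
  0 < t -> (forall j, (0 < a j)%N) -> (\prod_j a j)%:R <= t ->
  (0 < k)%N -> k%:R <= Delta * Num.sqrt t ->
  (forall i, (level a (x i) <= L)%N) ->
  (((L%:R / k%:R + 1)^-1 * ((sigma / (2 * Num.sqrt t) / 2) `^ q / 3))%:E <=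
   minimax_risk eps q (monotone_class x sigma Delta))%E.
Proof.
move=> t0 a0 at_ k0 kD levL.
have [m nm] := heavy_window k0 levL.
have st : 0 < Num.sqrt t by rewrite sqrtr_gt0.
pose delta := sigma / (2 * Num.sqrt t).
have d0 : 0 < delta by rewrite divr_gt0// mulr_gt0.
have d0' := ltW d0.
have H := window_lower_bound x_bij sigma0 epsN q0 a0 m k0 d0' _ _.
apply: le_trans (H Delta _ _).
- rewrite lee_fin ler_wpM2r ?divr_ge0 ?powR_ge0//.
  have n0 : 0 < (npts ns)%:R :> R by rewrite ltr0n npts_gt0.
  have k0R : 0 < k%:R :> R by rewrite ltr0n.
  have A0 : 0 < L%:R / k%:R + 1 :> R by rewrite ltr_wpDl// divr_ge0.
  rewrite ler_pdivlMr// mulrC ler_pdivrMr// mulrC.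
  apply: le_trans (_ : ((L %/ k).+1 * #|window x a k m|)%:R <= _).
    by rewrite ler_nat.
  rewrite natrM ler_wpM2r// -natr1 lerD2r ler_pdivlMr// -natrM ler_nat.
  exact: leq_trunc_div.
- rewrite mulrC /delta -mulrA ler_pM2l// mulrC ler_pdivrMr ?mulr_gt0//.
  apply: le_trans kD _; rewrite ler_wpM2l//; lra.
- apply: (@le_trans _ _ (delta ^+ 2 * t)); first by rewrite ler_wpM2l ?sqr_ge0.
  rewrite /delta expr_div_n exprMn sqr_sqrtr; last exact: ltW.
  rewrite le_eqVlt; apply/orP; left; apply/eqP; field.
  by rewrite gt_eqF.
Qed.

(** Two constant functions at distance sigma / (2 sqrt n) have total range 0
    and cannot be told apart reliably. *)
Lemma parametric_lower_bound :
  ((lower_const d * (sigma `^ q * (npts ns)%:R `^ (- q / 2)))%:E <=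
   minimax_risk eps q (monotone_class x sigma Delta))%E.
Proof.
have n0 : 0 < (npts ns)%:R :> R by rewrite ltr0n npts_gt0.
pose delta := sigma / (2 * Num.sqrt (npts ns)%:R).
have d0 : 0 < delta by rewrite divr_gt0// mulr_gt0// sqrtr_gt0.
pose f (b : bool) (v : d.-tuple nat) : R := if b then delta else 0.
have diff b i : tnth (value_vector x (f (~~ b))) i - tnth (value_vector x (f b)) i
    = (-1) ^+ b * delta.
  rewrite !tnth_mktuple /f.
  by case: b => /=; rewrite ?(expr1, expr0, mulN1r, mul1r, subr0, sub0r).
apply: le_trans (assouad sigma0 epsN q0 (E := bool) true
  (th := fun b => value_vector x (f b)) (flip := fun=> negb)
  (W := [set: _]%SET) (delta := delta) _ _ _ _ _).
- rewrite lee_fin cardsT card_ord divff ?gt_eqF// mul1r amplitude_powR//.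
  rewrite /lower_const [leRHS]mulrAC ler_wpM2r ?mulr_ge0 ?powR_ge0//.
  rewrite ler_wpM2l ?powR_ge0//.
  by rewrite lef_pV2 ?posrE ?mulr_gt0 ?ltr_wpDl ?mulr_ge0//
    ler_peMr// lerDr mulr_ge0.
- exact: ltW.
- move=> b; exists (f b) => //; split.
    by move=> u v j _ _ _ _; rewrite /f.
  by rewrite /total_range /f subrr mul0r.
- by move=> i _ b; exact: negbK.
- move=> i b _; rewrite distrC diff normrMsign ger0_norm// ltW//.
- move=> i b _; under eq_bigr do rewrite diff exprMn sqrr_sign mul1r.
  rewrite sumr_const card_ord /delta expr_div_n exprMn sqr_sqrtr; last exact: ltW.
  rewrite -mulr_natr.
  rewrite le_eqVlt; apply/orP; left; apply/eqP; field.
  by rewrite gt_eqF.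
Qed.

(** The boxes of side floor(n_j / l) in the first [s] directions and of side 1
    in the others, with l = (N_s / t)^(1/s): the volume is at most
    N_s / l^s = t, and since n_(s+1) <= l <= n_s no box coordinate exceeds
    2 l. *)
Lemma rate_lower_bound (s : nat) (t : R) :
  (1 <= s <= d)%N -> 1 <= t -> knot R ns s <= t -> t <= knot R ns s.+1 ->
  1 <= h0 Delta t ->
  ((lower_const d * (sigma `^ q * (t `^ (- q / 2) * Hpiece ns Delta s t)))%:E <=
   minimax_risk eps q (monotone_class x sigma Delta))%E.
Proof.
move=> /andP[s1 sd] t1 st tS h1.
have t0 : 0 < t by apply: lt_le_trans t1.
have Ns0 : 0 < (nstar ns s)%:R :> R by rewrite ltr0n nstar_gt0.
have s0R : s%:R != 0 :> R by rewrite pnatr_eq0 -lt0n.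
pose l := ((nstar ns s)%:R / t) `^ s%:R^-1.
have ls : l ^+ s = (nstar ns s)%:R / t.
  rewrite -powR_mulrn ?powR_ge0// -powRrM mulVf// powRr1//.
  by rewrite divr_ge0// ltW.
have l0 : 0 < l by rewrite powR_gt0// divr_gt0.
have side0 j : 0 < (side ns j)%:R :> R by rewrite ltr0n side_gt0.
have lS : (side ns s.+1)%:R <= l.
  rewrite -(ler_pXn2r s1) ?nnegrE ?(ltW (side0 _)) ?(ltW l0)// ls ler_pdivlMr//.
  move: tS; rewrite knotS// ler_pdivlMr ?exprn_gt0//.
  by rewrite mulrC.
have l_s : l <= (side ns s)%:R.
  rewrite -(ler_pXn2r s1) ?nnegrE ?(ltW (side0 _)) ?(ltW l0)// ls ler_pdivrMr//.
  by move: st; rewrite /knot ler_pdivrMr ?exprn_gt0// mulrC.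
have l1 : 1 <= l by apply: le_trans lS; rewrite ler1n side_gt0.
pose k := Num.truncn (h0 Delta t).
have h00 : 0 <= h0 Delta t by apply: le_trans h1.
have k0 : (0 < k)%N by rewrite truncn_gt0.
have kh : k%:R <= h0 Delta t by rewrite truncn_le.
have hk : h0 Delta t <= 2 * k%:R.
  have := truncnS_gt (h0 Delta t); rewrite -/k -natr1.
  have : 1 <= k%:R :> R by rewrite ler1n.
  lra.
pose a (j : 'I_d) : nat :=
  if (j < s)%N then Num.truncn ((tnth ns j)%:R / l) else 1%N.
have sideE (j : 'I_d) : tnth ns j = side ns j.+1 by rewrite /side (tnth_nth 1%N).
have njl (j : 'I_d) : (j < s)%N -> 1 <= (tnth ns j)%:R / l.
  move=> js; rewrite ler_pdivlMr// mul1r; apply: le_trans l_s _.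
  rewrite ler_nat.
  have s1d : (s.-1 < d)%N by rewrite prednK.
  have -> : side ns s = tnth ns (Ordinal s1d) by rewrite sideE /= prednK.
  by apply: ns_noninc => /=; rewrite -ltnS prednK.
have a0 j : (0 < a j)%N.
  by rewrite /a; case: ifP => // js; rewrite truncn_gt0 njl.
have prod_a : (\prod_j a j)%:R <= t.
  apply: (@le_trans _ _
    (\prod_(j < d) (if (j < s)%N then (side ns j.+1)%:R / l else 1))).
    rewrite natr_prod; apply: ler_prod => j _; rewrite ler0n /a /=.
    case: ifP => // js; rewrite -sideE truncn_le.
    by rewrite divr_ge0// ltW.
  rewrite -(big_mkord xpredT (fun j =>
    if (j < s)%N then (side ns j.+1)%:R / l else 1)).
  rewrite (big_cat_nat (leq0n s) sd)/= [X in _ * X <= _]big_nat_cond.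
  rewrite [X in _ * X <= _]big1 ?mulr1; last first.
    by move=> j /andP[/andP[sj _] _]; rewrite ltnNge sj.
  under eq_big_nat => j /andP[_ js] do rewrite js.
  rewrite prodf_div prodr_const_nat subn0 ls /nstar natr_prod big_add1 /=.
  rewrite invf_div mulrCA divff ?mulr1// gt_eqF//.
  by rewrite prodr_gt0.
pose L := (\sum_(j < d) (tnth ns j).-1 %/ a j)%N.
have levL i : (level a (x i) <= L)%N.
  apply: leq_sum => j _; rewrite leq_div2r// -!subn1 leq_sub2r//.
  have : lattice ns (x i) by case: x_bij => xf _ _; exact: xf.
  by move=> /(_ j)/andP[].
have Ll : L%:R <= 2 * d%:R * l.
  have -> : 2 * d%:R * l = \sum_(j < d) (2 * l).
    by rewrite sumr_const card_ord -mulr_natr; ring.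
  rewrite natr_sum; apply: ler_sum => j _.
  have nj0 : 0 < (tnth ns j)%:R :> R by rewrite ltr0n ns_ge1.
  have [js|js] := ltnP j s.
    (* The floor of a number that is at least 1 exceeds half of it. *)
    have aj : (tnth ns j)%:R <= 2 * l * (a j)%:R.
      rewrite /a js mulrAC -ler_pdivrMr//.
      have := truncnS_gt ((tnth ns j)%:R / l); rewrite -natr1.
      have : 1 <= (Num.truncn ((tnth ns j)%:R / l))%:R :> R.
        by rewrite ler1n truncn_gt0 njl.
      lra.
    have aj0 : 0 < (a j)%:R :> R by rewrite ltr0n.
    rewrite -(ler_pM2r aj0); apply: le_trans aj.
    by rewrite -natrM ler_nat (leq_trans (leq_trunc_div _ _))// leq_pred.
  rewrite /a ltnNge js /= divn1.
  apply: (@le_trans _ _ l); last by lra.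
  apply: le_trans lS; rewrite ler_nat (leq_trans (leq_pred _))//.
  have sd' : (s < d)%N by exact: leq_ltn_trans js _.
  have -> : side ns s.+1 = tnth ns (Ordinal sd') by rewrite sideE.
  exact: ns_noninc.
apply: le_trans (block_lower_bound t0 a0 prod_a k0 kh levL).
rewrite lee_fin amplitude_powR// /Hpiece -/l (minn_idPl sd) -/l.
set h := h0 Delta t in h1 h00 kh hk *.
have p0 : 0 <= 4^-1 `^ q * (sigma `^ q * t `^ (- q / 2)) / 3.
  by rewrite divr_ge0// !mulr_ge0 ?powR_ge0.
rewrite /lower_const.
have k0R : 0 < k%:R :> R by rewrite ltr0n.
have -> : 4^-1 `^ q / (3 * (4 * d%:R + 1)) *
    (sigma `^ q * (t `^ (- q / 2) * Num.min 1 (h / l))) =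
    (Num.min 1 (h / l) / (4 * d%:R + 1)) *
    (4^-1 `^ q * (sigma `^ q * t `^ (- q / 2)) / 3).
  by field; rewrite gt_eqF// ltr_wpDl// mulr_ge0.
rewrite ler_wpM2r// ler_pdivrMr; last by rewrite ltr_wpDl// mulr_ge0.
rewrite [leRHS]mulrC ler_pdivlMr; last by rewrite ltr_wpDl// divr_ge0.
have m1 : Num.min 1 (h / l) <= 1 by rewrite ge_min lexx.
have m2 : Num.min 1 (h / l) <= h / l by rewrite ge_min lexx orbT.
have m0 : 0 <= Num.min 1 (h / l) by rewrite le_min ler01 divr_ge0// ltW.
rewrite mulrDr mulr1 lerD//.
apply: (@le_trans _ _ (h / l * (2 * d%:R * l / k%:R))).
  rewrite ler_pM ?divr_ge0// ler_wpM2r ?invr_ge0// ltW//.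
have -> : h / l * (2 * d%:R * l / k%:R) = 2 * d%:R * (h / k%:R).
  by field; rewrite !gt_eqF.
have : h / k%:R <= 2 by rewrite ler_pdivrMr.
have : 0 <= d%:R :> R by [].
nra.
Qed.

End rate_lower_bound.

(** * The maximum of the rate *)

Section rate_formula.
Context (R : realType) (d : nat) (ns : d.-tuple nat).
Hypothesis ns_noninc :
  forall i j : 'I_d, (i <= j)%N -> (tnth ns j <= tnth ns i)%N.
Hypothesis ns_ge1 : forall j : 'I_d, (1 <= tnth ns j)%N.
Variables (q Delta : R).
Hypotheses (hq : 1 <= q) (hd : (1 <= d)%N) (Delta0 : 0 <= Delta).

Local Notation N s := ((nstar ns s)%:R : R).
Local Notation sd s := ((side ns s)%:R : R).
Local Notation n := ((npts ns)%:R : R).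
Local Notation knot := (knot R ns).

Lemma powR_gt0D (x r u : R) : 0 < x -> x `^ (r + u) = x `^ r * x `^ u.
Proof. by move=> x0; rewrite powRD// (gt_eqF x0) implybT. Qed.

Let N0 s : 0 < N s. Proof. by rewrite ltr0n nstar_gt0. Qed.
Let sd0 s : 0 < sd s. Proof. by rewrite ltr0n side_gt0. Qed.
Let sd1 s : 1 <= sd s. Proof. by rewrite ler1n side_gt0. Qed.
Let n1 : 1 <= n. Proof. by rewrite -nstar_npts ler1n nstar_gt0. Qed.
Let n0 : 0 < n. Proof. exact: lt_le_trans n1. Qed.
Let k0 s : 0 < knot s. Proof. exact: knot_gt0. Qed.

Lemma knot1 : knot 1 = 1.
Proof. by rewrite /Defs.knot /nstar big_nat1 expr1 divff// gt_eqF. Qed.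

Lemma side_last : side ns d.+1 = 1%N.
Proof. by rewrite /side nth_default// size_tuple. Qed.

Lemma knot_last : knot d.+1 = n.
Proof. by rewrite knotS// side_last expr1n divr1 nstar_npts. Qed.

Lemma le_knot s u : (1 <= s)%N -> (s <= u)%N -> knot s <= knot u.
Proof.
move=> s1 /subnKC <-; elim: (u - s)%N => [|m IH]; first by rewrite addn0.
apply: le_trans IH _; rewrite addnS; apply: le_knotS => //.
exact: leq_trans s1 (leq_addr _ _).
Qed.

Lemma knot_ge1 s : (1 <= s)%N -> 1 <= knot s.
Proof. by rewrite -[leLHS]knot1; exact: le_knot. Qed.

Lemma knot_le_npts s : (1 <= s <= d.+1)%N -> knot s <= n.
Proof. by move=> /andP[s1 sS]; rewrite -knot_last; exact: le_knot. Qed.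

Lemma exists_piece (t : R) : 1 <= t -> t <= n ->
  exists s, [/\ (1 <= s <= d)%N, knot s <= t & t <= knot s.+1].
Proof.
move=> t1 tn.
have ex : exists s, (s < d)%N && (t <= knot s.+2).
  by exists d.-1; rewrite ltn_predL hd prednK// knot_last.
have [s /andP[sd_ ts] smin] := ex_minnP ex.
exists s.+1; split => //.
case: s ts smin sd_ => [|s] ts smin sd_; first by rewrite knot1.
rewrite leNgt; apply/negP => lt_t.
by have := smin s; rewrite (ltnW sd_) ltW//= ltnn => /(_ isT).
Qed.

Lemma exists_piece_ge s (t : R) : (1 <= s <= d)%N -> knot s <= t -> t <= n ->
  exists j, [/\ (s <= j <= d)%N, knot j <= t & t <= knot j.+1].
Proof.
move=> /andP[s1 sd_] st tn.
have [j [/andP[j1 jd] jt tj]] := exists_piece (le_trans (knot_ge1 s1) st) tn.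
have [sj|js] := leqP s j; first by exists j; rewrite sj.
exists s; rewrite leqnn sd_; split => //; apply: le_trans tj _.
by apply: le_knot => //; exact: leqW.
Qed.

Lemma root_nstar_knot s : (0 < s)%N -> N s `^ s%:R^-1 = sd s * knot s `^ s%:R^-1.
Proof.
move=> s0; rewrite -[sd s in RHS](powR_root s0 (ltW (sd0 s))).
rewrite -powRM ?exprn_ge0// ?ltW//; congr (_ `^ _).
by rewrite /Defs.knot mulrCA divff ?mulr1// gt_eqF// exprn_gt0.
Qed.

Lemma root_nstar_knotS s : (0 < s)%N ->
  N s `^ s%:R^-1 = sd s.+1 * knot s.+1 `^ s%:R^-1.
Proof.
move=> s0; rewrite -[sd s.+1 in RHS](powR_root s0 (ltW (sd0 s.+1))).
rewrite -powRM ?exprn_ge0// ?ltW//; congr (_ `^ _).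
by rewrite knotS// mulrCA divff ?mulr1// gt_eqF// exprn_gt0.
Qed.

(** [branch s t] is t^(-q/2) h_0(t) / (N_s / t)^(1/s), with the powers of [t]
    collected. *)
Definition branch_exp (s : nat) : R := 2^-1 + s%:R^-1 - q / 2.

Definition branch (s : nat) (t : R) : R :=
  Delta / N s `^ s%:R^-1 * t `^ branch_exp s.

(** The common value of the branches [s.-1] and [s] at the knot [t_s]; see
    [branch_knot] and [branch_knotS]. *)
Definition knot_value (s : nat) : R :=
  Delta / (sd s * knot s `^ ((q - 1) / 2)).

Lemma powR_branchE s t : (1 <= s <= d)%N -> 0 < t ->
  t `^ (- q / 2) * Hpiece ns Delta s t =
  Num.min (t `^ (- q / 2)) (branch s t).
Proof.
move=> /andP[s1 sd_] t0; rewrite /Hpiece (minn_idPl sd_).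
rewrite minr_pMr ?powR_ge0// mulr1; congr Num.min.
rewrite /branch /branch_exp /h0 powRM ?invr_ge0 ?ltW//.
have -> : t^-1 `^ s%:R^-1 = (t `^ s%:R^-1)^-1.
  by rewrite -(powR_inv1 (ltW t0)) -powRrM mulN1r powRN.
rewrite -(powR12_sqrt (ltW t0)).
have -> : 2^-1 + s%:R^-1 - q / 2 = - q / 2 + 2^-1 + s%:R^-1 by ring.
rewrite !powR_gt0D//; field.
by rewrite !gt_eqF ?powR_gt0.
Qed.

Lemma branch_le s t u : 0 <= branch_exp s -> 0 < t -> t <= u ->
  branch s t <= branch s u.
Proof.
move=> e0 t0 tu; rewrite ler_wpM2l ?divr_ge0 ?powR_ge0//.
by apply: ge0_ler_powR; rewrite ?nnegrE// ltW// (lt_le_trans t0).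
Qed.

Lemma branch_ge s t u : branch_exp s <= 0 -> 0 < t -> t <= u ->
  branch s u <= branch s t.
Proof.
move=> e0 t0 tu; rewrite ler_wpM2l ?divr_ge0 ?powR_ge0//.
have u0 := lt_le_trans t0 tu.
rewrite -[branch_exp s]opprK !(powRN _ (- _)) lef_pV2 ?posrE ?powR_gt0//.
by apply: ge0_ler_powR; rewrite ?nnegrE ?oppr_ge0// ltW.
Qed.

Lemma branch_knot s : (1 <= s)%N -> branch s (knot s) = knot_value s.
Proof.
move=> s1; rewrite /branch /knot_value root_nstar_knot// -mulrA; congr (_ * _).
have -> : branch_exp s = s%:R^-1 + - ((q - 1) / 2).
  by rewrite /branch_exp; field; rewrite pnatr_eq0 -lt0n.
rewrite powR_gt0D// powRN !invfM -mulrA; congr (_ * _).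
by rewrite mulKf// gt_eqF// powR_gt0.
Qed.

Lemma branch_knotS s : (1 <= s)%N -> branch s (knot s.+1) = knot_value s.+1.
Proof.
move=> s1; rewrite /branch /knot_value root_nstar_knotS// -mulrA; congr (_ * _).
have -> : branch_exp s = s%:R^-1 + - ((q - 1) / 2).
  by rewrite /branch_exp; field; rewrite pnatr_eq0 -lt0n.
rewrite powR_gt0D// powRN !invfM -mulrA; congr (_ * _).
by rewrite mulKf// gt_eqF// powR_gt0.
Qed.

Lemma branch_exp_le s u : (1 <= s)%N -> (s <= u)%N ->
  branch_exp u <= branch_exp s.
Proof.
move=> s1 su; rewrite /branch_exp lerD2r lerD2l lef_pV2 ?posrE ?ltr0n//.
  by rewrite ler_nat.
exact: leq_trans su.
Qed.

Lemma knot_value_le s u : (1 <= s)%N -> (s <= u)%N ->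
  (forall j, (s <= j < u)%N -> 0 <= branch_exp j) ->
  knot_value s <= knot_value u.
Proof.
move=> s1 /subnKC <-; elim: (u - s)%N => [|m IH] e0; first by rewrite addn0.
have sm1 : (1 <= s + m)%N by exact: leq_trans s1 (leq_addr _ _).
apply: le_trans (IH _) _.
  by move=> j /andP[sj jm]; apply: e0; rewrite sj addnS ltnW.
rewrite addnS -(branch_knotS sm1) -(branch_knot sm1); apply: branch_le => //.
  by apply: e0; rewrite leq_addr addnS ltnSn.
exact: le_knotS.
Qed.

Lemma knot_value_ge s u : (1 <= s)%N -> (s <= u)%N -> branch_exp s <= 0 ->
  knot_value u <= knot_value s.
Proof.
move=> s1 /subnKC <- e0; elim: (u - s)%N => [|m IH]; first by rewrite addn0.
have sm1 : (1 <= s + m)%N by exact: leq_trans s1 (leq_addr _ _).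
apply: le_trans _ IH.
rewrite addnS -(branch_knotS sm1) -(branch_knot sm1); apply: branch_ge => //.
  by apply: le_trans e0; apply: branch_exp_le => //; exact: leq_addr.
exact: le_knotS.
Qed.

Lemma branch_le_knot s t u : (1 <= s)%N -> (s < u)%N ->
  (forall j, (s <= j < u)%N -> 0 <= branch_exp j) ->
  0 < t -> t <= knot s.+1 -> branch s t <= knot_value u.
Proof.
move=> s1 su e0 t0 ts.
apply: (@le_trans _ _ (knot_value s.+1)).
  by rewrite -branch_knotS//; apply: branch_le => //; apply: e0; rewrite leqnn.
apply: knot_value_le => // j /andP[sj ju]; apply: e0.
by rewrite ju (ltnW sj).
Qed.

Lemma branch_ge_knot s t u : (1 <= u)%N -> (u <= s)%N -> branch_exp u <= 0 ->
  knot s <= t -> branch s t <= knot_value u.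
Proof.
move=> u1 us e0 st; apply: le_trans (knot_value_ge u1 us e0).
rewrite -branch_knot ?(leq_trans u1)//; apply: branch_ge => //.
by apply: le_trans e0; exact: branch_exp_le.
Qed.

Lemma H_le1 t : H ns Delta t <= 1.
Proof. by rewrite /H /Hpiece ge_min lexx. Qed.

Lemma powR_decr (t u : R) : 0 < t -> t <= u -> u `^ (- q / 2) <= t `^ (- q / 2).
Proof.
move=> t0 tu; have u0 := lt_le_trans t0 tu.
rewrite !mulNr !powRN lef_pV2 ?posrE ?powR_gt0//.
apply: ge0_ler_powR; rewrite ?nnegrE ?(ltW t0) ?(ltW u0)//.
by rewrite divr_ge0// (le_trans ler01).
Qed.

Lemma rate_le_pow (t tau : R) : 0 < tau -> tau <= t -> tau <= n ->
  (Num.min t n) `^ (- q / 2) * H ns Delta t <= tau `^ (- q / 2).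
Proof.
move=> tau0 tt tn; rewrite -[leRHS]mulr1 ler_pM ?powR_ge0 ?H_le1//.
  rewrite /H /Hpiece le_min ler01 divr_ge0 ?powR_ge0//.
  by rewrite mulr_ge0 ?sqrtr_ge0.
by apply: powR_decr => //; rewrite le_min tt.
Qed.

Lemma rate_pieceE s t : (1 <= s <= d)%N -> knot s <= t -> t <= knot s.+1 ->
  (Num.min t n) `^ (- q / 2) * H ns Delta t =
  Num.min (t `^ (- q / 2)) (branch s t).
Proof.
move=> ssd st ts; have /andP[s1 sd_] := ssd.
have tn : t <= n by apply: le_trans ts _; apply: knot_le_npts.
rewrite (min_idPl tn) (@H_pieceE _ _ _ Delta ns_noninc ns_ge1 s) ?s1 ?leqW//.
by rewrite powR_branchE// (lt_le_trans (k0 s)).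
Qed.

Lemma rate_le_beyond_npts (V t : R) : n <= t -> n `^ (- q / 2) <= V ->
  (Num.min t n) `^ (- q / 2) * H ns Delta t <= V.
Proof. by move=> nt; apply: le_trans; exact: rate_le_pow. Qed.

(** Beyond [n] the rate is at most n^(-q/2), which the value at the last knot
    already exceeds; this lets the falling branches bound those scales. *)
Lemma npts_le_knot_value : 1 <= Delta * Num.sqrt n ->
  n `^ (- q / 2) <= knot_value d.+1.
Proof.
move=> h; rewrite /knot_value side_last mul1r knot_last.
have -> : - q / 2 = - ((q - 1) / 2) + - 2^-1 by field.
rewrite powR_gt0D// powRN mulrC powRN ler_pM2r ?invr_gt0 ?powR_gt0//.
by rewrite powR12_sqrt ?(ltW n0)// -[leLHS]div1r ler_pdivrMr ?sqrtr_gt0.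
Qed.

Lemma is_rate_max_intro t V : 0 < Delta -> 1 <= t -> 1 <= h0 Delta t ->
  (Num.min t n) `^ (- q / 2) * H ns Delta t = V ->
  (forall u, 1 <= u -> 1 <= h0 Delta u ->
    (Num.min u n) `^ (- q / 2) * H ns Delta u <= V) ->
  is_rate_max q ns Delta V.
Proof.
move=> D0 t1 h1 tV Vub; rewrite /is_rate_max gt_eqF//; split.
  by exists t => //=; rewrite le_min t1.
by move=> _ [u /= + <-]; rewrite le_min => /andP[u1 hu]; exact: Vub.
Qed.

Lemma rate_one_max : sd 1 <= Delta -> is_rate_max q ns Delta 1.
Proof.
move=> sD; have D0 : 0 < Delta by exact: lt_le_trans sD.
apply: (@is_rate_max_intro 1) => //.
- by rewrite /h0 sqrtr1 mulr1 (le_trans (sd1 1)).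
- rewrite (@rate_pieceE 1) ?knot1// ?knot_ge1//.
  rewrite powR1 (min_idPl _)// -knot1 branch_knot// /knot_value knot1 powR1.
  by rewrite mulr1 ler_pdivlMr// mul1r.
- by move=> u u1 _; have := rate_le_pow ltr01 u1 n1; rewrite powR1.
Qed.

(** At [tau] the branch meets t^(-q/2).  Before [tau] the rate is bounded by
    the rising branches, after it by the decreasing power. *)
Lemma rate_crossing_max s : (1 <= s <= d)%N -> 0 <= branch_exp s ->
  sd s.+1 / Num.sqrt (knot s.+1) <= Delta ->
  Delta <= sd s / Num.sqrt (knot s) ->
  is_rate_max q ns Delta ((Delta / N s `^ s%:R^-1) `^ (q * s%:R / (2 + s%:R))).
Proof.
move=> ssd e0 Dlo Dhi; have /andP[s1 sd_] := ssd.
have sqk j : 0 < Num.sqrt (knot j) by rewrite sqrtr_gt0.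
have D0 : 0 < Delta by apply: lt_le_trans Dlo; rewrite divr_gt0.
have s0R : 0 < s%:R :> R by rewrite ltr0n.
have Ns0 : 0 < N s `^ s%:R^-1 by rewrite powR_gt0.
pose p : R := 2^-1 + s%:R^-1.
have p0 : 0 < p by rewrite addr_gt0 ?invr_gt0.
(* The solution of branch s tau = tau^(-q/2). *)
pose tau := (N s `^ s%:R^-1 / Delta) `^ p^-1.
have tau0 : 0 < tau by rewrite powR_gt0// divr_gt0.
have taup : tau `^ p = N s `^ s%:R^-1 / Delta.
  by rewrite -powRrM mulVf ?gt_eqF// powRr1// ltW// divr_gt0.
have pow_le (t u : R) : 0 < t -> 0 < u -> (t `^ p <= u `^ p) = (t <= u).
  move=> t0 u0; apply/idP/idP; last first.
    by move=> tu; apply: ge0_ler_powR => //; rewrite ?nnegrE ltW.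
  apply: contraTT; rewrite -!ltNge => ut.
  by apply: gt0_ltr_powR; rewrite ?nnegrE ?(ltW t0) ?(ltW u0).
have kp j : knot j `^ p = Num.sqrt (knot j) * knot j `^ s%:R^-1.
  by rewrite powR_gt0D// powR12_sqrt// ltW.
have tau_lo : knot s <= tau.
  rewrite -pow_le// taup kp root_nstar_knot// ler_pdivlMr// mulrAC.
  rewrite ler_pM2r ?powR_gt0// mulrC.
  by move: Dhi; rewrite ler_pdivlMr.
have tau_hi : tau <= knot s.+1.
  rewrite -pow_le// taup kp root_nstar_knotS// ler_pdivrMr// mulrAC.
  rewrite ler_pM2r ?powR_gt0// mulrC.
  by move: Dlo; rewrite ler_pdivrMr.
have tau1 : 1 <= tau by apply: le_trans tau_lo; exact: knot_ge1.
have taun : tau <= n by apply: le_trans tau_hi _; exact: knot_le_npts.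
have btau : branch s tau = tau `^ (- q / 2).
  rewrite /branch /branch_exp -/p mulNr powR_gt0D// taup.
  by rewrite mulrA; field; rewrite !gt_eqF.
have -> : (Delta / N s `^ s%:R^-1) `^ (q * s%:R / (2 + s%:R)) = tau `^ (- q / 2).
  have -> : Delta / N s `^ s%:R^-1 = (N s `^ s%:R^-1 / Delta) `^ (- 1).
    by rewrite powR_inv1 ?invf_div// divr_ge0// ltW.
  rewrite -!powRrM.
  congr (_ `^ _); rewrite /p; field.
  by rewrite !gt_eqF// addr_gt0.
apply: (@is_rate_max_intro tau) => //.
- have : h0 Delta tau * tau `^ s%:R^-1 = N s `^ s%:R^-1.
    rewrite /h0 -powR12_sqrt ?ltW// -mulrA -powR_gt0D// -/p taup.
    by rewrite mulrC divfK// gt_eqF.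
  rewrite -(ler_pM2r (powR_gt0 s%:R^-1 tau0)) => ->; rewrite mul1r.
  rewrite root_nstar_knotS//.
  apply: (@le_trans _ _ (knot s.+1 `^ s%:R^-1)).
    by apply: ge0_ler_powR => //; rewrite ?nnegrE ltW.
  by rewrite ler_peMl ?powR_ge0.
- by rewrite (rate_pieceE ssd)// btau minxx.
move=> u u1 _.
have [tu|ut] := leP tau u; first exact: rate_le_pow.
have u0 : 0 < u by exact: lt_le_trans u1.
have [j [/andP[j1 jd] ju uj]] := exists_piece u1 (le_trans (ltW ut) taun).
rewrite (rate_pieceE _ ju uj) ?j1// ge_min; apply/orP; right.
rewrite -btau.
have [sj|js] := leqP s j.
  have [js|sj'] := leqP j s.
    have -> : j = s by apply/eqP; rewrite eqn_leq js sj.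
    by apply: branch_le => //; exact: ltW.
  have sjk : knot s.+1 <= knot j by exact: le_knot.
  by have := le_lt_trans (le_trans tau_hi (le_trans sjk ju)) ut; rewrite ltxx.
apply: (@le_trans _ _ (knot_value s)).
  apply: branch_le_knot => // i /andP[ji is_].
  apply: le_trans e0 _; apply: branch_exp_le; last exact: ltnW.
  exact: leq_trans ji.
by rewrite -branch_knot//; apply: branch_le.
Qed.

(** The branches rise up to [t_s] and fall afterwards. *)
Lemma rate_knot_max s : (1 <= s <= d)%N ->
  (forall j, (1 <= j < s)%N -> 0 <= branch_exp j) -> branch_exp s <= 0 ->
  (Num.sqrt (knot s))^-1 <= Delta -> Delta <= sd s / Num.sqrt (knot s) ->
  is_rate_max q ns Delta (Delta / (sd s * knot s `^ ((q - 1) / 2))).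
Proof.
move=> ssd einc edec Dlo Dhi; have /andP[s1 sd_] := ssd.
rewrite -[X in is_rate_max _ _ _ X]/(knot_value s).
have sqk j : 0 < Num.sqrt (knot j) by rewrite sqrtr_gt0.
have D0 : 0 < Delta by apply: lt_le_trans Dlo; rewrite invr_gt0.
have hks : 1 <= h0 Delta (knot s).
  by rewrite /h0 -ler_pdivrMr// div1r.
apply: (@is_rate_max_intro (knot s)) => //.
- exact: knot_ge1.
- rewrite (rate_pieceE ssd)// ?le_knotS// branch_knot//.
  apply/min_idPr; rewrite /knot_value.
  have -> : - q / 2 = - ((q - 1) / 2) + - 2^-1 by field.
  rewrite powR_gt0D// !powRN powR12_sqrt ?(ltW (k0 s))//.
  rewrite ler_pdivrMr ?mulr_gt0 ?powR_gt0//; apply: le_trans Dhi _.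
  rewrite le_eqVlt; apply/orP; left; apply/eqP; field.
  by rewrite !gt_eqF ?powR_gt0.
move=> u u1 _; have u0 : 0 < u by exact: lt_le_trans u1.
have [nu|] := boolP (n <= u); last rewrite -ltNge => un.
  apply: rate_le_beyond_npts => //.
  apply: le_trans (npts_le_knot_value _) _.
    apply: le_trans hks _; rewrite /h0 ler_pM2l// (ler_sqrt _ (ltW n0)).
    by rewrite knot_le_npts// s1 leqW.
  by apply: knot_value_ge => //; exact: leqW.
have [j [/andP[j1 jd] ju uj]] := exists_piece u1 (ltW un).
rewrite (rate_pieceE _ ju uj) ?j1// ge_min; apply/orP; right.
have [sj|js] := leqP s j; first exact: branch_ge_knot.
apply: branch_le_knot => // i /andP[ji is_]; apply: einc.
by rewrite is_ (leq_trans j1).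
Qed.

(** The constraint h_0(t) >= 1 means t >= Delta^(-2), a scale in the [s]-th
    piece, from which on the branches fall. *)
Lemma rate_above_max s : (1 <= s <= d)%N -> branch_exp s <= 0 ->
  (Num.sqrt (knot s.+1))^-1 <= Delta -> Delta <= (Num.sqrt (knot s))^-1 ->
  is_rate_max q ns Delta (Delta `^ (q - 2 / s%:R) / N s `^ s%:R^-1).
Proof.
move=> ssd edec Dlo Dhi; have /andP[s1 sd_] := ssd.
have sqk j : 0 < Num.sqrt (knot j) by rewrite sqrtr_gt0.
have D0 : 0 < Delta by apply: lt_le_trans Dlo; rewrite invr_gt0.
have s0R : 0 < s%:R :> R by rewrite ltr0n.
(* The scale where h_0 reaches 1. *)
pose t0 := Delta `^ (- 2).
have t00 : 0 < t0 by rewrite powR_gt0.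
have sqt0 : Num.sqrt t0 = Delta^-1.
  by rewrite -powR12_sqrt ?ltW// -powRrM mulNr divff// powR_inv1// ltW.
have sqle (t u : R) : 0 < t -> 0 < u -> Num.sqrt t <= Num.sqrt u -> t <= u.
  by move=> t_0 u_0; rewrite ler_sqrt// ltW.
have t0lo : knot s <= t0.
  apply: sqle => //; rewrite sqt0 -[leLHS]invrK lef_pV2 ?posrE ?invr_gt0//.
have t0hi : t0 <= knot s.+1.
  by apply: sqle => //; rewrite sqt0 -[leRHS]invrK lef_pV2 ?posrE ?invr_gt0.
have bt0 : branch s t0 = Delta `^ (q - 2 / s%:R) / N s `^ s%:R^-1.
  rewrite /branch mulrAC; congr (_ / _).
  rewrite -{1}(powRr1 (ltW D0)) -powRrM -powR_gt0D//.
  by congr (_ `^ _); rewrite /branch_exp; field; rewrite gt_eqF.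
have hD u : 0 < u -> 1 <= h0 Delta u -> t0 <= u.
  move=> u0; rewrite /h0 mulrC -ler_pdivrMr// div1r -sqt0; exact: sqle.
rewrite -bt0.
apply: (@is_rate_max_intro t0) => //.
- by apply: le_trans t0lo; exact: knot_ge1.
- by rewrite /h0 sqt0 divff// gt_eqF.
- rewrite (rate_pieceE ssd)//; apply/min_idPr.
  have -> : branch s t0 = t0 `^ (- q / 2) / (N s `^ s%:R^-1 / t0 `^ s%:R^-1).
    rewrite /branch /branch_exp.
    have -> : 2^-1 + s%:R^-1 - q / 2 = - q / 2 + 2^-1 + s%:R^-1 by ring.
    rewrite !powR_gt0D// powR12_sqrt ?ltW// sqt0.
    by field; rewrite !gt_eqF ?powR_gt0.
  rewrite ler_pdivrMr ?divr_gt0 ?powR_gt0// ler_peMr ?powR_ge0//.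
  rewrite ler_pdivlMr ?powR_gt0// mul1r root_nstar_knotS//.
  apply: (@le_trans _ _ (knot s.+1 `^ s%:R^-1)).
    by apply: ge0_ler_powR => //; rewrite ?nnegrE ltW.
  by rewrite ler_peMl ?powR_ge0.
move=> u u1 hu; have u0 : 0 < u by exact: lt_le_trans u1.
have t0u := hD u u0 hu.
have V : knot_value s.+1 <= branch s t0.
  by rewrite -branch_knotS//; exact: branch_ge.
have edecS : branch_exp s.+1 <= 0.
  by apply: le_trans edec; exact: branch_exp_le.
have [nu|] := boolP (n <= u); last rewrite -ltNge => un.
  apply: rate_le_beyond_npts => //.
  apply: le_trans (npts_le_knot_value _) _.
    have : 1 <= Delta * Num.sqrt (knot s.+1) by rewrite -ler_pdivrMr// div1r.
    move/le_trans; apply; rewrite ler_pM2l// (ler_sqrt _ (ltW n0)).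
    exact: knot_le_npts.
  by apply: le_trans V; exact: knot_value_ge.
have [j [/andP[sj jd] ju uj]] := exists_piece_ge ssd (le_trans t0lo t0u) (ltW un).
rewrite (rate_pieceE _ ju uj) ?(leq_trans s1)// ge_min; apply/orP; right.
have [sj'|js] := ltnP s j.
  by apply: le_trans V; exact: branch_ge_knot.
have -> : j = s by apply/eqP; rewrite eqn_leq js sj.
exact: branch_ge.
Qed.

(** The constraint h_0(t) >= 1 leaves only scales beyond [n], and H = 1 at
    t = Delta^(-2). *)
Lemma rate_parametric_max : Delta <= (Num.sqrt n)^-1 ->
  is_rate_max q ns Delta (n `^ (- q / 2)).
Proof.
move=> Dhi; have sqn : 0 < Num.sqrt n by rewrite sqrtr_gt0.
rewrite /is_rate_max; case: eqVneq => // Dn0.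
have D0 : 0 < Delta by rewrite lt_neqAle eq_sym Dn0.
pose t := (Delta^-1) ^+ 2.
have t0 : 0 < t by rewrite exprn_gt0 ?invr_gt0.
have sqt : Num.sqrt t = Delta^-1 by rewrite sqrtr_sqr ger0_norm// invr_ge0.
have nt u : 0 <= u -> 1 <= h0 Delta u -> n <= u.
  move=> u0; rewrite /h0 mulrC -ler_pdivrMr// div1r => Du.
  rewrite -(ler_sqrt _ u0); apply: le_trans Du.
  by rewrite -[leLHS]invrK lef_pV2 ?posrE ?invr_gt0.
have ht : h0 Delta t = 1 by rewrite /h0 sqt divff// gt_eqF.
have nt' : n <= t by apply: nt; [exact: ltW|rewrite ht].
have := @is_rate_max_intro t (n `^ (- q / 2)) D0.
rewrite /is_rate_max (negbTE Dn0); apply.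
- exact: le_trans nt'.
- by rewrite ht.
- rewrite (min_idPr nt') (@H_pieceE _ _ _ Delta ns_noninc ns_ge1 d.+1) ?leqnn//.
  + rewrite /Hpiece ht (min_idPl _) ?mulr1//.
    have X0 : 0 < (N d.+1 / t) `^ (minn d.+1 d)%:R^-1.
      by apply: powR_gt0; rewrite divr_gt0.
    rewrite (ler_pdivlMr _ _ X0) mul1r.
    have nst : N d.+1 / t <= 1.
      by rewrite ler_pdivrMr// mul1r nstarS side_last muln1 nstar_npts.
    apply: (@le_trans _ _ (1 `^ (minn d.+1 d)%:R^-1)); last by rewrite powR1.
    by apply: ge0_ler_powR => //; rewrite ?nnegrE// divr_ge0// ltW.
  + by rewrite knot_last.
  + by rewrite ltnn.
- by move=> u u1 hu; apply: rate_le_pow => //; apply: nt => //; exact: le_trans u1.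
Qed.

Lemma s_q_gt0 : (0 < s_q q d)%N.
Proof.
rewrite /s_q; case: eqP => // /eqP q1; rewrite leq_min andbT absz_gt0.
have c0 : 0 < 2 / (q - 1) by rewrite divr_gt0// subr_gt0 lt_neqAle eq_sym q1.
by rewrite gt_eqF// ceil_gt0.
Qed.

Lemma branch_exp_ge0 s : (0 < s)%N -> (0 <= branch_exp s) = ((q - 1) * s%:R <= 2).
Proof.
move=> s0; have s0R : 0 < s%:R :> R by rewrite ltr0n.
rewrite -(pmulr_lge0 _ s0R) -[RHS]subr_ge0.
rewrite -(pmulr_lge0 (2 - (q - 1) * s%:R) (x := 2^-1))//.
by congr (0 <= _); rewrite /branch_exp; field; rewrite gt_eqF.
Qed.

Lemma branch_exp_le0 s : (0 < s)%N -> (branch_exp s <= 0) = (2 <= (q - 1) * s%:R).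
Proof.
move=> s0; have s0R : 0 < s%:R :> R by rewrite ltr0n.
rewrite -(pmulr_lle0 _ s0R) -[RHS]subr_le0.
rewrite -(pmulr_lle0 (2 - (q - 1) * s%:R) (x := 2^-1))//.
by congr (_ <= 0); rewrite /branch_exp; field; rewrite gt_eqF.
Qed.

Lemma branch_exp_below s : (1 <= s < s_q q d)%N -> 0 <= branch_exp s.
Proof.
move=> /andP[s0]; rewrite branch_exp_ge0// /s_q.
case: eqP => [->|/eqP q1]; first by rewrite subrr mul0r.
have q10 : 0 < q - 1 by rewrite subr_gt0 lt_neqAle eq_sym q1.
rewrite leq_min => /andP[+ _].
have c0 : 0 <= Num.ceil (2 / (q - 1)).
  by rewrite ceil_ge0 (@lt_trans _ _ 0)// divr_gt0.
rewrite ltnNge => sc; rewrite mulrC -ler_pdivlMr// leNgt.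
apply/negP => /ltW cs; move/negP: sc; apply.
by rewrite -lez_nat gez0_abs// ceil_le_int.
Qed.

Lemma branch_exp_above s : (s_q q d <= s <= d)%N -> branch_exp s <= 0.
Proof.
move=> /andP[+ sd_].
move=> sqs; have s0 : (0 < s)%N by exact: leq_trans s_q_gt0 sqs.
move: sqs; rewrite branch_exp_le0// /s_q.
case: eqP => [_|/eqP q1]; first by rewrite ltnNge sd_.
have q10 : 0 < q - 1 by rewrite subr_gt0 lt_neqAle eq_sym q1.
have c0 : 0 <= Num.ceil (2 / (q - 1)).
  by rewrite ceil_ge0 (@lt_trans _ _ 0)// divr_gt0.
rewrite geq_min [(d < s)%N]ltnNge sd_ orbF -lez_nat gez0_abs// => cs.
rewrite mulrC -ler_pdivrMr//; apply: le_trans (ceil_ge _) _.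
by rewrite -[s%:R]/((s%:Z)%:~R) ler_int.
Qed.

Lemma rate_case_is_max r : rate_case q ns Delta r -> is_rate_max q ns Delta r.
Proof.
case.
- exact: rate_one_max.
- move=> s ssq lo hi; have /andP[s1 sq] := ssq.
  apply: rate_crossing_max => //; last exact: branch_exp_below.
  rewrite s1 -ltnS (leq_trans sq)//; rewrite /s_q; case: ifP => // _.
  exact: geq_minr.
- move=> s -> sd_ lo hi; apply: rate_knot_max => //.
  + by rewrite s_q_gt0.
  + by move=> j; exact: branch_exp_below.
  + by apply: branch_exp_above; rewrite leqnn.
- move=> s ssq lo hi; apply: rate_above_max => //; last exact: branch_exp_above.
  by have /andP[sq ->] := ssq; rewrite (leq_trans s_q_gt0 sq).
- by move=> _; exact: rate_parametric_max.
Qed.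

Lemma s_q_le : (s_q q d <= d.+1)%N.
Proof. by rewrite /s_q; case: ifP => // _; exact: geq_minr. Qed.

(** Going down the thresholds n_s / sqrt t_s from s = 1 to s_q, then down
    1 / sqrt t_s from s_q to d + 1, the first one that Delta reaches
    determines the case. *)
Lemma rate_case_exists : exists r, rate_case q ns Delta r.
Proof.
have [sD|Ds] := leP (sd 1) Delta; first by exists 1; exact: RateOne.
have down s : (1 <= s)%N -> (s <= s_q q d)%N ->
    (exists r, rate_case q ns Delta r) \/ Delta <= sd s / Num.sqrt (knot s).
  elim: s => // s IH _ sS.
  case: s IH sS => [|s] IH sS.
    by right; rewrite knot1 sqrtr1 divr1 ltW.
  have [|Dhi] := IH isT (ltnW sS); first by left.
  have [Dlo|Dlo] := leP (sd s.+2 / Num.sqrt (knot s.+2)) Delta.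
    by left; eexists; apply: (RateBelow (s := s.+1)).
  by right; exact: ltW.
have [//|Dhi] := down _ s_q_gt0 (leqnn _).
have par : Delta <= (Num.sqrt (knot d.+1))^-1 -> exists r, rate_case q ns Delta r.
  by rewrite knot_last => Dn; eexists; exact: RateParametric.
move: s_q_le; rewrite leq_eqVlt => /predU1P[sqE|sqd].
  by apply: par; move: Dhi; rewrite sqE side_last div1r.
rewrite ltnS in sqd.
have [Dlo|Dlo] := leP (Num.sqrt (knot (s_q q d)))^-1 Delta.
  by eexists; apply: (RateAt (s := s_q q d)).
have up k : (s_q q d + k <= d.+1)%N ->
    (exists r, rate_case q ns Delta r) \/
    Delta <= (Num.sqrt (knot (s_q q d + k)))^-1.
  elim: k => [|k IH]; first by rewrite addn0; right; exact: ltW.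
  rewrite addnS => kd; have [|Dk] := IH (ltnW kd); first by left.
  have [Dlo'|Dlo'] := leP (Num.sqrt (knot (s_q q d + k).+1))^-1 Delta.
    by left; eexists; apply: (RateAbove (s := (s_q q d + k)%N));
      rewrite ?leq_addr.
  by right; exact: ltW.
have := up (d.+1 - s_q q d)%N; rewrite subnKC; last exact: leqW.
move=> /(_ (leqnn _)) [//|].
exact: par.
Qed.

Lemma rate_max_unique M M' : is_rate_max q ns Delta M ->
  is_rate_max q ns Delta M' -> M = M'.
Proof.
rewrite /is_rate_max; case: eqP => [_ -> -> //|_ [vM uM] [vM' uM']].
by apply/eqP; rewrite eq_le uM'// uM.
Qed.

(** * The cube *)

Section cube.
Let m : R := n `^ d%:R^-1.
Hypothesis cube : forall j : 'I_d, (tnth ns j)%:R = m.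
Hypothesis Dn : (Num.sqrt n)^-1 <= Delta.

Let one_d : (1 <= 1 <= d)%N. Proof. by rewrite hd. Qed.

Let D0 : 0 < Delta.
Proof. by apply: lt_le_trans Dn; rewrite invr_gt0 sqrtr_gt0. Qed.

Let m0 : 0 < m. Proof. exact: powR_gt0. Qed.

Lemma cube_side s : (1 <= s <= d)%N -> sd s = m.
Proof.
case: s => // s /= sd_; rewrite -(cube (Ordinal sd_)).
by rewrite /side (tnth_nth 1%N).
Qed.

Lemma cube_knot s : (1 <= s <= d)%N -> knot s = 1.
Proof.
move=> ssd; have /andP[s1 sd_] := ssd.
have -> : knot s = (N s) / m ^+ s by rewrite /Defs.knot cube_side.
rewrite /nstar natr_prod (eq_big_nat _ _ (F2 := fun=> m)).
  by rewrite prodr_const_nat subSS subn0 divff// expf_neq0// gt_eqF.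
by move=> j /andP[j1 js]; rewrite cube_side// j1 (leq_trans _ sd_).
Qed.

Let dd : (1 <= d <= d)%N. Proof. by rewrite hd leqnn. Qed.

Lemma cube_rate_low : q <= 1 + 2 / d%:R ->
  is_rate_max q ns Delta
    (Num.min 1 ((Delta / m) `^ (q * d%:R / (d%:R + 2)))).
Proof.
move=> qd; have d0R : 0 < d%:R :> R by rewrite ltr0n.
have e0 : 0 <= q * d%:R / (d%:R + 2).
  by rewrite divr_ge0 ?addr_ge0// mulr_ge0// (le_trans ler01).
have [mD|Dm] := leP m Delta.
  rewrite (min_idPl _); first by apply: rate_one_max; rewrite cube_side.
  apply: (@le_trans _ _ (1 `^ (q * d%:R / (d%:R + 2)))); first by rewrite powR1.
  apply: ge0_ler_powR => //; rewrite ?nnegrE ?divr_ge0 ?(ltW m0)//.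
  by rewrite ler_pdivlMr// mul1r.
rewrite (min_idPr _); last first.
  apply: (@le_trans _ _ (1 `^ (q * d%:R / (d%:R + 2)))); last by rewrite powR1.
  apply: ge0_ler_powR => //; rewrite ?nnegrE ?divr_ge0 ?(ltW m0)//.
  by rewrite ler_pdivrMr// mul1r ltW.
have := rate_crossing_max dd; rewrite nstar_npts -/m addrC; apply.
- rewrite /branch_exp; lra.
- by rewrite side_last knot_last div1r.
- by rewrite cube_side// cube_knot// sqrtr1 divr1 ltW.
Qed.

(** All knots up to [t_d] equal 1, so that the peak may be placed at the least
    [s] whose branch does not rise. *)
Lemma cube_rate_high : 1 + 2 / d%:R <= q ->
  is_rate_max q ns Delta
    (Num.min 1 (Num.min (Delta / m) (Delta `^ (q - 2 / d%:R) / m))).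
Proof.
move=> qd; have d0R : 0 < d%:R :> R by rewrite ltr0n.
have p1 : 1 <= q - 2 / d%:R by lra.
have ed : branch_exp d <= 0 by rewrite /branch_exp; lra.
have [D1|D1] := leP Delta 1.
  have Dp : Delta `^ (q - 2 / d%:R) <= Delta by rewrite ge1r_powR// D0.
  have m1 : 1 <= m by rewrite -(cube_side dd).
  have -> : Num.min 1 (Num.min (Delta / m) (Delta `^ (q - 2 / d%:R) / m)) =
      Delta `^ (q - 2 / d%:R) / m.
    rewrite (min_idPr (_ : _ <= Delta / m)); last by rewrite ler_pM2r ?invr_gt0.
    apply/min_idPr; rewrite ler_pdivrMr// mul1r.
    by apply: le_trans Dp _; exact: le_trans m1.
  have := rate_above_max dd; rewrite nstar_npts -/m; apply => //.
  + by rewrite knot_last.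
  + by rewrite cube_knot// sqrtr1 invr1.
have Dp : Delta <= Delta `^ (q - 2 / d%:R) by rewrite le1r_powR// ltW.
have -> : Num.min 1 (Num.min (Delta / m) (Delta `^ (q - 2 / d%:R) / m)) =
    Num.min 1 (Delta / m).
  by congr Num.min; apply/min_idPl; rewrite ler_pM2r ?invr_gt0.
have [mD|Dm] := leP m Delta.
  rewrite (min_idPl _); last by rewrite ler_pdivlMr// mul1r.
  by apply: rate_one_max; rewrite cube_side.
rewrite (min_idPr _); last by rewrite ler_pdivrMr// mul1r ltW.
have ex : exists s, (0 < s)%N && (branch_exp s <= 0) by exists d; rewrite hd.
have [s /andP[s1 es] smin] := ex_minnP ex.
have ssd : (1 <= s <= d)%N by rewrite s1 smin// hd.
have := rate_knot_max ssd.
rewrite cube_side// cube_knot// sqrtr1 powR1 mulr1 divr1 invr1; apply => //.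
- move=> j /andP[j1 js]; rewrite leNgt; apply/negP => /ltW ej.
  by have := smin j; rewrite j1 ej => /(_ isT); rewrite leqNgt js.
- exact: ltW.
- exact: ltW.
Qed.

End cube.

End rate_formula.

(** * The minimax lower bound *)

(** The maximum is attained at some scale [t]: a scale before [n] falls in a
    piece covered by [rate_lower_bound], and beyond [n] the rate is at most
    the parametric one. *)
Lemma rate_max_lower_bound (R : realType) (d : nat) (ns : d.-tuple nat)
    (x : 'I_(npts ns) -> d.-tuple nat) (sigma Delta q M : R)
    (disp : measure_display) (T : measurableType disp) (P : probability T R)
    (eps : 'I_(npts ns) -> {RV P >-> R}) :
  1 <= q -> (1 <= d)%N ->
  (forall i j : 'I_d, (i <= j)%N -> (tnth ns j <= tnth ns i)%N) ->
  (forall j : 'I_d, (1 <= tnth ns j)%N) ->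
  set_bij [set: 'I_(npts ns)] (lattice ns) x ->
  0 < sigma -> 0 <= Delta -> iid_gaussian eps sigma ->
  is_rate_max q ns Delta M ->
  ((lower_const q d * (sigma `^ q * M))%:E
     <= minimax_risk eps q (monotone_class x sigma Delta))%E.
Proof.
move=> q1 d1 noninc ge1 bij s0 D0 epsN.
have q0 : 0 <= q by exact: le_trans ler01 q1.
have par := parametric_lower_bound x ge1 s0 D0 epsN q0.
rewrite /is_rate_max; case: eqP => [_ -> //|_ [[t /= + tM] _]].
rewrite le_min => /andP[t1 ht].
have [nt|tn] := leP (npts ns)%:R t.
  apply: le_trans par; rewrite lee_fin ler_wpM2l ?(ltW (lower_const_gt0 _ _))//.
  rewrite ler_wpM2l ?powR_ge0// -tM.
  by apply: rate_le_pow => //; rewrite ltr0n npts_gt0.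
have [s [ssd st ts]] := exists_piece ge1 d1 t1 (ltW tn).
have t0 : 0 < t by exact: lt_le_trans t1.
have := rate_lower_bound noninc ge1 bij s0 D0 epsN q0 ssd t1 st ts ht.
by rewrite powR_branchE// -(rate_pieceE noninc ge1 q Delta ssd st ts) tM.
Qed.

Theorem proposition1 (R : realType) (q : R) (d : nat)
    (hq : 1 <= q) (hd : (1 <= d)%N) :
  exists2 c : R, 0 < c &
  forall (ns : d.-tuple nat) (x : 'I_(npts ns) -> d.-tuple nat)
    (sigma Delta : R)
    (disp : measure_display) (T : measurableType disp) (P : probability T R)
    (eps : 'I_(npts ns) -> {RV P >-> R}),
  (forall i j : 'I_d, (i <= j)%N -> (tnth ns j <= tnth ns i)%N) ->
  (forall j : 'I_d, (1 <= tnth ns j)%N) ->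
  set_bij [set: 'I_(npts ns)] (lattice ns) x ->
  0 < sigma ->
  0 <= Delta ->
  iid_gaussian eps sigma ->
  exists M : R,
  [/\ is_rate_max q ns Delta M,
      ((c * (sigma `^ q * M))%:E
         <= minimax_risk eps q (monotone_class x sigma Delta))%E,
      (exists r : R, rate_case q ns Delta r),
      (forall r : R, rate_case q ns Delta r -> M = r) &
      let m := (npts ns)%:R `^ d%:R^-1 in
      (forall j : 'I_d, (tnth ns j)%:R = m) ->
      (Num.sqrt (npts ns)%:R)^-1 <= Delta ->
      (q <= 1 + 2 / d%:R ->
         M = Num.min 1 ((Delta / m) `^ (q * d%:R / (d%:R + 2)))) /\
      (1 + 2 / d%:R <= q ->
         M = Num.min 1 (Num.min (Delta / m) (Delta `^ (q - 2 / d%:R) / m)))].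
Proof.
exists (lower_const q d); first exact: lower_const_gt0.
move=> ns x sigma Delta disp T P eps noninc ge1 bij s0 D0 epsN.
have [M caseM] := rate_case_exists ge1 hq D0.
have maxM := rate_case_is_max noninc ge1 hq hd D0 caseM.
have uniq M' : is_rate_max q ns Delta M' -> M = M' by exact: rate_max_unique.
exists M; split => //.
- exact: rate_max_lower_bound.
- by exists M.
- by move=> r caser; apply: uniq; exact: rate_case_is_max.
move=> m cube Dn; split => qd; apply: uniq.
- exact: cube_rate_low.
- exact: cube_rate_high.
Qed.
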